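(* There is an algorithm that, given a fully quantified Boolean formula $\psi$ in prenex normal form together with a tree decomposition of width $k$ of its primal graph $G_\psi$, decides whether $\psi$ is valid (i.e., solves QSAT) in time $$\mathrm{tower}\big(\mathrm{qa}(\psi)+1,\;k+3.92\big)\cdot \mathrm{poly}(|\psi|).$$
   Context: Tower notation: $\mathrm{tower}(0,t)=t$ and $\mathrm{tower}(h+1,t)=2^{\mathrm{tower}(h,t)}$, i.e. a tower of twos of height $h$ with $t$ at the top. A quantified Boolean formula (QBF) here is fully quantified and in prenex normal form: $Q_1S_1\dots Q_\ell S_\ell .\,\mu$, where the $S_i$ are disjoint sets of propositional variables, $Q_i\in\{\exists,\forall\}$ and $\mu$ (the matrix) is quantifier-free. The matrix is a CNF if the innermost quantifier is existential and a DNF otherwise. QSAT is the problem of deciding whether a given QBF is valid (evaluates to true). $\mathrm{qa}(\psi)$ is the number of quantifier alternations of the prefix (number of maximal blocks of equal quantifiers minus one). The primal graph $G_\psi$ has as vertices the variables of $\psi$ and connects two variables by an edge if they occur together in a clause (or term) of the matrix. Tree decompositions and their width (maximum bag size minus one) are defined as usual. *)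

(* Defs.v *)
From HB Require Import structures.
From mathcomp Require Import all_boot all_order all_algebra.
From mathcomp Require Import reals exp.

Set Implicit Arguments.
Unset Strict Implicit.
Unset Printing Implicit Defensive.

Inductive quantifier := Exists | Forall.

Definition is_exists (q : quantifier) : bool :=
  if q is Exists then true else false.
Definition of_is_exists (b : bool) : quantifier := if b then Exists else Forall.
Lemma is_existsK : cancel is_exists of_is_exists.
Proof. by case. Qed.
HB.instance Definition _ := Equality.copy quantifier (can_type is_existsK).

(* (true, x) is the literal x and (false, x) its negation. *)
Definition literal := (bool * nat)%type.

(* [qblocks] is Q_1 S_1 ... Q_l S_l from left to right, and [qmatrix] lists the
   clauses (or the terms), each as the list of its literals. *)
Record qbf := QBF {
  qblocks : seq (quantifier * seq nat);
  qmatrix : seq (seq literal) }.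

Definition qprefix (psi : qbf) : seq (quantifier * nat) :=
  flatten [seq [seq (Qi.1, x) | x <- Qi.2] | Qi <- qblocks psi].

Definition qvars (psi : qbf) : seq nat := unzip2 (qprefix psi).

Definition clause_vars (c : seq literal) : seq nat := unzip2 c.

(* [uniq] says both that each S_i is listed without repetition and that the
   S_i are pairwise disjoint; the second condition says that the formula is
   fully quantified. *)
Definition qbf_wf (psi : qbf) : bool :=
  uniq (qvars psi) &&
  all (fun c => all (mem (qvars psi)) (clause_vars c)) (qmatrix psi).

(* Without any block the matrix is a DNF, hence the default [Forall]. *)
Definition innermost (psi : qbf) : quantifier :=
  last Forall (unzip1 (qblocks psi)).

Definition lit_true (a : nat -> bool) (l : literal) : bool := a l.2 == l.1.

Definition eval_matrix (psi : qbf) (a : nat -> bool) : bool :=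
  if innermost psi == Exists
  then all (has (lit_true a)) (qmatrix psi)
  else has (all (lit_true a)) (qmatrix psi).

Definition assign (a : nat -> bool) (x : nat) (b : bool) : nat -> bool :=
  fun y => if y == x then b else a y.

Fixpoint qeval (pre : seq (quantifier * nat)) (mu : (nat -> bool) -> bool)
    (a : nat -> bool) : bool :=
  match pre with
  | [::] => mu a
  | (Exists, x) :: pre' =>
      qeval pre' mu (assign a x false) || qeval pre' mu (assign a x true)
  | (Forall, x) :: pre' =>
      qeval pre' mu (assign a x false) && qeval pre' mu (assign a x true)
  end.

(* The initial assignment is irrelevant: the formula is closed. *)
Definition valid (psi : qbf) : bool :=
  qeval (qprefix psi) (eval_matrix psi) (fun=> false).

(* The number of maximal runs of equal quantifiers, each run being counted at
   its last element. *)
Fixpoint nruns (s : seq quantifier) : nat :=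
  if s is q :: s' then (ohead s' != Some q) + nruns s' else 0.

Definition qa (psi : qbf) : nat := (nruns (unzip1 (qblocks psi))).-1.

(* The vertex set of the primal graph is [qvars psi]. *)
Definition primal_edge (psi : qbf) : rel nat := fun x y =>
  (x != y) &&
  has (fun c => (x \in clause_vars c) && (y \in clause_vars c)) (qmatrix psi).

(* A rooted ordered tree whose nodes are labelled with bags. *)
Inductive tdec := TNode of seq nat & seq tdec.

(* A node is named by its address, the sequence of child indices leading to it
   from the root. Addresses outside the tree get an empty bag, so that a vertex
   in [bag_at T a] is always in the bag of a genuine node of T. *)
Fixpoint bag_at (T : tdec) (a : seq nat) {struct a} : seq nat :=
  let: TNode b ts := T in
  if a is i :: a' then bag_at (nth (TNode [::] [::]) ts i) a' else b.

Definition is_parent : rel (seq nat) := fun a b =>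
  (b != [::]) && (a == take (size b).-1 b).

Definition tree_adj : rel (seq nat) := fun a b => is_parent a b || is_parent b a.

Record tree_decomposition (psi : qbf) (T : tdec) : Prop := TreeDecomposition {
  td_bag_uniq : forall a, uniq (bag_at T a);
  td_bag_sub : forall a, {subset bag_at T a <= qvars psi};
  td_vertex : forall x, x \in qvars psi -> exists a, x \in bag_at T a;
  td_edge : forall x y, primal_edge psi x y ->
    exists a, (x \in bag_at T a) && (y \in bag_at T a);
  td_connected : forall x a b, x \in bag_at T a -> x \in bag_at T b ->
    exists p : seq (seq nat),
      [/\ path tree_adj a p, last a p = b & all (fun c => x \in bag_at T c) p] }.

Fixpoint max_bag_size (T : tdec) : nat :=
  let: TNode b ts := T in foldr maxn (size b) (map max_bag_size ts).

(* An integer: the width is -1 when all bags are empty. *)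
Definition width (T : tdec) : int := ((max_bag_size T)%:Z - 1)%R.

Inductive symbol :=
  | SBit of bool | SSign of bool | SQuant of quantifier | SOpen | SClose.

(* Least significant digit first; 0 has the single digit 0. *)
Definition bits (n : nat) : seq bool :=
  mkseq (fun i => odd (n %/ 2 ^ i)) (trunc_log 2 n).+1.

Definition enc_nat (n : nat) : seq symbol :=
  SOpen :: map SBit (bits n) ++ [:: SClose].

Definition enc_seq (A : Type) (enc : A -> seq symbol) (s : seq A) : seq symbol :=
  SOpen :: flatten (map enc s) ++ [:: SClose].

Definition enc_literal (l : literal) : seq symbol := SSign l.1 :: enc_nat l.2.

Definition enc_block (Qi : quantifier * seq nat) : seq symbol :=
  SQuant Qi.1 :: enc_seq enc_nat Qi.2.

Definition enc_qbf (psi : qbf) : seq symbol :=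
  enc_seq enc_block (qblocks psi) ++
  enc_seq (enc_seq enc_literal) (qmatrix psi).

Fixpoint enc_tdec (T : tdec) : seq symbol :=
  let: TNode b ts := T in enc_seq enc_nat b ++ enc_seq enc_tdec ts.

Definition qbf_size (psi : qbf) : nat := size (enc_qbf psi).
Definition tdec_size (T : tdec) : nat := size (enc_tdec T).

(* While programs for a random access machine. Arithmetic is restricted to
   successor and predecessor: after t steps every stored number is at most t
   plus the largest constant of the program or symbol code of the input, so
   words of O(log t) bits suffice and charging one unit per instruction is an
   honest measure of time. *)
Inductive program :=
  | Const (x c : nat)
  | Move (x y : nat)
  | Succ (x y : nat)
  | Pred (x y : nat)
  | Read (x y : nat)
  | Write (x y : nat)
  | Skip
  | Seq (P1 P2 : program)
  | If (x : nat) (P1 P2 : program)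
  | While (x : nat) (P : program).

Record state := State { reg : nat -> nat; memory : nat -> nat }.

Definition upd (f : nat -> nat) (x v : nat) : nat -> nat :=
  fun y => if y == x then v else f y.

Definition set_reg (s : state) (x v : nat) : state :=
  State (upd (reg s) x v) (memory s).

Definition set_mem (s : state) (i v : nat) : state :=
  State (reg s) (upd (memory s) i v).

(* [exec P s t s']: started in s, the program P halts in s' after t steps. *)
Inductive exec : program -> state -> nat -> state -> Prop :=
  | exec_Const x c s : exec (Const x c) s 1 (set_reg s x c)
  | exec_Move x y s : exec (Move x y) s 1 (set_reg s x (reg s y))
  | exec_Succ x y s : exec (Succ x y) s 1 (set_reg s x (reg s y).+1)
  | exec_Pred x y s : exec (Pred x y) s 1 (set_reg s x (reg s y).-1)
  | exec_Read x y s : exec (Read x y) s 1 (set_reg s x (memory s (reg s y)))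
  | exec_Write x y s : exec (Write x y) s 1 (set_mem s (reg s x) (reg s y))
  | exec_Skip s : exec Skip s 1 s
  | exec_Seq P1 P2 s1 s2 s3 t1 t2 :
      exec P1 s1 t1 s2 -> exec P2 s2 t2 s3 -> exec (Seq P1 P2) s1 (t1 + t2) s3
  | exec_IfT x P1 P2 s s' t :
      reg s x != 0 -> exec P1 s t s' -> exec (If x P1 P2) s t.+1 s'
  | exec_IfF x P1 P2 s s' t :
      reg s x = 0 -> exec P2 s t s' -> exec (If x P1 P2) s t.+1 s'
  | exec_WhileF x P s : reg s x = 0 -> exec (While x P) s 1 s
  | exec_WhileT x P s1 s2 s3 t1 t2 :
      reg s1 x != 0 -> exec P s1 t1 s2 -> exec (While x P) s2 t2 s3 ->
      exec (While x P) s1 (t1 + t2).+1 s3.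

(* Codes are positive, so that the first 0 in memory marks the end of the
   input. *)
Definition symbol_code (c : symbol) : nat :=
  match c with
  | SBit false => 1
  | SBit true => 2
  | SSign false => 3
  | SSign true => 4
  | SQuant Exists => 5
  | SQuant Forall => 6
  | SOpen => 7
  | SClose => 8
  end.

Definition init_state (w : seq symbol) : state :=
  State (fun=> 0) (nth 0 (map symbol_code w)).

Definition outputs (P : program) (w : seq symbol) (t : nat) (b : bool) : Prop :=
  exists s : state, exec P (init_state w) t s /\ reg s 0 = nat_of_bool b.

Fixpoint tower (R : realType) (h : nat) (t : R) : R :=
  if h is h'.+1 then powR 2 (tower h' t) else t.

(* Main.v *)
Require Import Defs.
From HB Require Import structures.
From mathcomp Require Import all_boot all_order all_algebra.
From mathcomp Require Import reals exp.
From mathcomp Require Import zify lra.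

Set Implicit Arguments.
Unset Strict Implicit.
Unset Printing Implicit Defensive.

(* The algorithm is a dynamic programming over the tree decomposition. Fix a
   node and consider the clauses checked in its subtree. The type of this CNF is
   built block by block: it is a decision tree over the bag variables of the
   first block, and each of its leaves is the set of the types, for the remaining
   blocks, that can be reached by choosing the variables of the first block that
   occur only below the bag. After the last block, which may be assumed to be
   existential (otherwise the formula is negated), the set records whether some
   choice satisfies the clauses. Sets are kept as increasing lists without
   repetition. The type of a node is obtained from those of its children by
   projecting away the variables that leave the bag (a union of sets) and by
   joining pointwise (a product of sets); at the root only nested sets remain,
   and the formula is evaluated on them like on a game tree.

   With bags of size B = k + 1 there are at most tower(qa + 1, B) types for the
   blocks after the first, so that the operations, which are cubic in the number
   of types at every alternation, take time tower(qa + 1, B + 2), up to a factor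
   that is polynomial in the input; and B + 2 <= k + 3.92. By the Helly property
   of subtrees every clause is contained in some bag, where it is checked.

   The program is written in a first-order functional language on binary trees,
   which an abstract machine runs on the random access machine with constant
   overhead. *)

(** Quantifiers do not enter the types. A set collects what can be reached by choosing the hidden
    variables of a block, whoever chooses; only the evaluation at the root reads it as a disjunction
    or a conjunction. One projection and one join thus serve both quantifiers. Dropping order and
    multiplicity is harmless for either of them, and it is what bounds the number of types. The join
    may be a pointwise product because connectedness makes the hidden variables of its two sides
    disjoint, so that the choices are independent.

    The 2 added at the top of the tower pays for the cube: with [a] bag variables,
    [3 * 2 ^ a + a <= 2 ^ (a + 2)] in the exponent.

    Time is measured in function calls, in machine steps and in instructions, each at a constant
    factor from the previous one. Values are passed as pointers, so the size of a tree enters only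
    where the tree is traversed. *)

Inductive tree := Leaf | Fork of tree & tree.

Definition thd (t : tree) : tree := if t is Fork a _ then a else Leaf.
Definition ttl (t : tree) : tree := if t is Fork _ b then b else Leaf.
Definition tlist (s : seq tree) : tree := foldr Fork Leaf s.
Definition tnat (n : nat) : tree := iter n (Fork Leaf) Leaf.
Definition tbool (b : bool) : tree := if b then Fork Leaf Leaf else Leaf.
Fixpoint tget (t : tree) (n : nat) : tree :=
  if n is n'.+1 then tget (ttl t) n' else thd t.

(** * Straight-line tree programs on the random access machine *)

Inductive cmd :=
  | CLeaf (x : nat)
  | CMove (x y : nat)
  | CFork (x y z : nat)
  | CHd (x y : nat)
  | CTl (x y : nat)
  | CSeq (c1 c2 : cmd)
  | CIf (x : nat) (c1 c2 : cmd).

Notation "c1 ;; c2" := (CSeq c1 c2) (at level 95, right associativity).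

Fixpoint crun (c : cmd) (s : seq tree) : seq tree :=
  match c with
  | CLeaf x => set_nth Leaf s x Leaf
  | CMove x y => set_nth Leaf s x (nth Leaf s y)
  | CFork x y z => set_nth Leaf s x (Fork (nth Leaf s y) (nth Leaf s z))
  | CHd x y => set_nth Leaf s x (thd (nth Leaf s y))
  | CTl x y => set_nth Leaf s x (ttl (nth Leaf s y))
  | CSeq c1 c2 => crun c2 (crun c1 s)
  | CIf x c1 c2 => if nth Leaf s x is Fork _ _ then crun c1 s else crun c2 s
  end.

(* Register 0 is the output, register 1 the first free memory cell, register 2
   is scratch and register 3 is left to the input loop; the tree register x is
   the register x + 5. Forks are allocated once and never overwritten. *)
Fixpoint compile (c : cmd) : program :=
  match c with
  | CLeaf x => Const x.+1.+4 0
  | CMove x y => Move x.+1.+4 y.+1.+4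
  | CFork x y z =>
      Seq (Write 1 y.+1.+4) (Seq (Succ 2 1) (Seq (Write 2 z.+1.+4)
        (Seq (Move x.+1.+4 1) (Succ 1 2))))
  | CHd x y => If y.+1.+4 (Read x.+1.+4 y.+1.+4) (Const x.+1.+4 0)
  | CTl x y =>
      If y.+1.+4 (Seq (Succ 2 y.+1.+4) (Read x.+1.+4 2)) (Const x.+1.+4 0)
  | CSeq c1 c2 => Seq (compile c1) (compile c2)
  | CIf x c1 c2 => If x.+1.+4 (compile c1) (compile c2)
  end.

Fixpoint ctime (c : cmd) : nat :=
  match c with
  | CSeq c1 c2 => ctime c1 + ctime c2
  | CIf _ c1 c2 => (ctime c1 + ctime c2).+1
  | _ => 5
  end.

(** Pointer 0 is a leaf, and a fork occupies two adjacent cells below the allocation pointer [h].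
    Sharing is allowed, so that copying a tree is copying a pointer. *)
Fixpoint points_to (m : nat -> nat) (h p : nat) (t : tree) : Prop :=
  match t with
  | Leaf => p = 0
  | Fork a b => [/\ 0 < p, p.+1 < h, points_to m h (m p) a
                  & points_to m h (m p.+1) b]
  end.

Lemma points_to_mono m m' h h' p t :
  (forall i, i < h -> m' i = m i) -> h <= h' ->
  points_to m h p t -> points_to m' h' p t.
Proof.
move=> em hh'; elim: t p => [//|a IHa b IHb] p /= [p0 ph pa pb].
rewrite !em ?(ltnW ph) //; split=> //; first exact: leq_trans hh'.
  exact: IHa.
exact: IHb.
Qed.

(** A positive allocation pointer keeps new forks away from address 0, which denotes a leaf. *)
Definition represents (s : state) (r : seq tree) : Prop :=
  0 < reg s 1 /\
  forall x, points_to (memory s) (reg s 1) (reg s x.+1.+4) (nth Leaf r x).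

(** What the input loop needs from a compiled command: its counter and the unread input survive. *)
Definition extends (s s' : state) : Prop :=
  [/\ reg s' 3 = reg s 3, reg s 1 <= reg s' 1
    & forall i, i < reg s 1 -> memory s' i = memory s i].

Lemma extends_trans s1 s2 s3 : extends s1 s2 -> extends s2 s3 -> extends s1 s3.
Proof.
move=> [e1 l1 m1] [e2 l2 m2]; split; first by rewrite e2.
  exact: leq_trans l2.
by move=> i Hi; rewrite m2 ?m1 //; apply: leq_trans l1.
Qed.

Lemma represents_set_reg s r x p t :
  represents s r -> points_to (memory s) (reg s 1) p t ->
  represents (set_reg s x.+1.+4 p) (set_nth Leaf r x t).
Proof.
move=> [h0 Hr] pt; split=> // y; rewrite nth_set_nth /= /upd !eqSS.
by case: ifP => // _; apply: Hr.
Qed.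

Lemma represents_tmp s r p : represents s r -> represents (set_reg s 2 p) r.
Proof. by case. Qed.

Lemma exec_compile c s r :
  represents s r ->
  exists s' t, [/\ exec (compile c) s t s', represents s' (crun c r),
                   extends s s' & t <= ctime c].
Proof.
elim: c s r => [x|x y|x y z|x y|x y|c1 IH1 c2 IH2|x c1 IH1 c2 IH2] s r Hs /=.
- exists (set_reg s x.+1.+4 0), 1; split=> //; first exact: exec_Const.
  exact: represents_set_reg.
- exists (set_reg s x.+1.+4 (reg s y.+1.+4)), 1; split=> //.
    exact: exec_Move.
  by apply: represents_set_reg => //; case: Hs.
- do 2!eexists; split.
  + apply: exec_Seq; first exact: exec_Write.
    apply: exec_Seq; first exact: exec_Succ.
    apply: exec_Seq; first exact: exec_Write.
    apply: exec_Seq; [exact: exec_Move | exact: exec_Succ].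
  + case: Hs => h0 Hr; split=> //= k.
    rewrite nth_set_nth /= /upd /= !eqSS.
    set h := reg s 1 in h0 Hr *.
    have Hk u : points_to (memory s) h (reg s u.+1.+4) (nth Leaf r u) ->
      points_to (fun i => if i == h.+1 then reg s z.+1.+4 else
        if i == h then reg s y.+1.+4 else memory s i) h.+2
        (reg s u.+1.+4) (nth Leaf r u).
      apply: points_to_mono => //; last by rewrite -addn2 leq_addr.
      by move=> i Hi; rewrite !ifN // neq_ltn ?Hi // ltnS ltnW.
    case: (k == x) => /=; last by apply: Hk; apply: Hr.
    rewrite !eqxx /= ltn_eqF ?ltnSn //; split=> //; exact/Hk/Hr.
  + split=> //= [|i Hi]; first by rewrite /upd /=; lia.
    by rewrite /upd /= !ifN // neq_ltn ?Hi // ltnS ltnW.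
  + by [].
- have [h0 Hr] := Hs; have := Hr y; case: (nth Leaf r y) => [|a b] /=.
    move=> e; exists (set_reg s x.+1.+4 0), 2; split=> //.
      by apply: exec_IfF => //; apply: exec_Const.
    exact: represents_set_reg.
  case=> p0 _ pa pb.
  exists (set_reg s x.+1.+4 (memory s (reg s y.+1.+4))), 2; split=> //.
    by apply: exec_IfT; rewrite -?lt0n //; apply: exec_Read.
  exact: represents_set_reg.
- have [h0 Hr] := Hs; have := Hr y; case: (nth Leaf r y) => [|a b] /=.
    move=> e; exists (set_reg s x.+1.+4 0), 2; split=> //.
      by apply: exec_IfF => //; apply: exec_Const.
    exact: represents_set_reg.
  case=> p0 _ pa pb.
  do 2!eexists; split.
  + apply: exec_IfT; first by rewrite -lt0n.
    apply: exec_Seq; [exact: exec_Succ | exact: exec_Read].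
  + by apply: represents_set_reg => //; apply: represents_tmp.
  + by split.
  + by [].
- have [s1 [t1 [E1 R1 X1 T1]]] := IH1 _ _ Hs.
  have [s2 [t2 [E2 R2 X2 T2]]] := IH2 _ _ R1.
  exists s2, (t1 + t2); split=> //; first exact: exec_Seq E2.
    exact: extends_trans X2.
  exact: leq_add.
- have [h0 Hr] := Hs; have := Hr x; case: (nth Leaf r x) => [|a b] /=.
    move=> e; have [s2 [t2 [E2 R2 X2 T2]]] := IH2 _ _ Hs.
    exists s2, t2.+1; split=> //; first exact: exec_IfF.
    by rewrite ltnS (leq_trans T2) // leq_addl.
  case=> p0 _ _ _; have [s1 [t1 [E1 R1 X1 T1]]] := IH1 _ _ Hs.
  exists s1, t1.+1; split=> //; first by apply: exec_IfT; rewrite -?lt0n.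
  by rewrite ltnS (leq_trans T1) // leq_addr.
Qed.

Fixpoint cbuild (x : nat) (t : tree) : cmd :=
  if t is Fork a b then cbuild x a ;; cbuild x.+1 b ;; CFork x x x.+1
  else CLeaf x.

Lemma crun_cbuild x t r :
  nth Leaf (crun (cbuild x t) r) x = t /\
  forall y, y < x -> nth Leaf (crun (cbuild x t) r) y = nth Leaf r y.
Proof.
elim: t x r => [|a IHa b IHb] x r /=.
  split=> [|y yx]; rewrite nth_set_nth /= ?eqxx //.
  by rewrite ifN // neq_ltn yx.
have [a1 a2] := IHa x r; have [b1 b2] := IHb x.+1 (crun (cbuild x a) r).
split=> [|y yx]; rewrite nth_set_nth /= ?eqxx.
  by rewrite b1 b2 // a1.
by rewrite ifN ?b2 ?a2 ?ltnS ?(ltnW yx) // neq_ltn yx.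
Qed.

(** * A first-order functional language and its abstract machine *)

(* Environments are trees read as lists, and variables are de Bruijn indices
   into them; [TMatch e e1 e2] runs e2 with the two halves of a fork pushed on
   the environment, and [TCall f e] runs the f-th body with the value of e as
   its whole environment. *)
Inductive term :=
  | TVar (n : nat)
  | TLeaf
  | TFork (e1 e2 : term)
  | TMatch (e e1 e2 : term)
  | TCall (f : nat) (e : term).

(* Counting the calls suffices: the machine time between two calls is bounded by
   a constant of the program. *)
Inductive eval (defs : seq term) : tree -> term -> tree -> nat -> Prop :=
  | eval_Var env n : eval defs env (TVar n) (tget env n) 0
  | eval_Leaf env : eval defs env TLeaf Leaf 0
  | eval_Fork env e1 e2 v1 v2 c1 c2 :
      eval defs env e1 v1 c1 -> eval defs env e2 v2 c2 ->
      eval defs env (TFork e1 e2) (Fork v1 v2) (c1 + c2)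
  | eval_MatchLeaf env e e1 e2 v c1 c2 :
      eval defs env e Leaf c1 -> eval defs env e1 v c2 ->
      eval defs env (TMatch e e1 e2) v (c1 + c2)
  | eval_MatchFork env e e1 e2 a b v c1 c2 :
      eval defs env e (Fork a b) c1 ->
      eval defs (Fork a (Fork b env)) e2 v c2 ->
      eval defs env (TMatch e e1 e2) v (c1 + c2)
  | eval_Call env f e v w c1 c2 :
      eval defs env e v c1 -> eval defs v (nth TLeaf defs f) w c2 ->
      eval defs env (TCall f e) w (c1 + c2).+1.

Fixpoint enc_term (e : term) : tree :=
  match e with
  | TVar n => Fork (tnat 0) (tnat n)
  | TLeaf => Fork (tnat 1) Leaf
  | TFork e1 e2 => Fork (tnat 2) (Fork (enc_term e1) (enc_term e2))
  | TMatch e e1 e2 =>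
      Fork (tnat 3) (Fork (enc_term e) (Fork (enc_term e1) (enc_term e2)))
  | TCall f e => Fork (tnat 4) (Fork (enc_term e) (tnat f))
  end.

Definition enc_defs (defs : seq term) : tree := tlist (map enc_term defs).

(* A leaf in [rC] means that the value in [rV]
   is to be returned to the topmost frame of the stack [rK]. *)
Notation rRun := 0. Notation rC := 1. Notation rE := 2. Notation rK := 3.
Notation rV := 4. Notation rD := 5. Notation rT := 6. Notation rP := 7.
Notation rA := 8. Notation rZ := 9. Notation rX := 10.

Fixpoint cswitch (cs : seq cmd) : cmd :=
  match cs with
  | [::] => CLeaf rZ
  | [:: c] => c
  | c :: cs' => CIf rT (CTl rT rT ;; cswitch cs') c
  end.

Fixpoint ctag (n : nat) : cmd :=
  if n is n'.+1 then ctag n' ;; CFork rX rZ rX else CLeaf rZ ;; CLeaf rX.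

(* The payload of the frame is taken from [rA]. *)
Definition cpush (n : nat) : cmd :=
  ctag n ;; CFork rX rX rA ;; CFork rK rX rK.

(** Frames 0 and 3 wait for the two halves of a fork, frame 1 for the scrutinee of a match, frame 2
    for the argument of a call. The body of a call is then fetched like a variable, with the
    definitions in [rD] as environment, while frame 4 keeps the argument. A variable takes one step
    per unit of its index. *)
Definition cstep : cmd :=
  CIf rC
    (CHd rT rC ;; CTl rP rC ;; cswitch [::
      CIf rP (CTl rP rP ;; CLeaf rZ ;; CFork rC rZ rP ;; CTl rE rE)
             (CHd rV rE ;; CLeaf rC);
      CLeaf rV ;; CLeaf rC;
      CTl rA rP ;; CFork rA rA rE ;; cpush 0 ;; CHd rC rP;
      CTl rA rP ;; CFork rA rA rE ;; cpush 1 ;; CHd rC rP;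
      CTl rA rP ;; cpush 2 ;; CHd rC rP])
    (CIf rK
      (CHd rP rK ;; CTl rK rK ;; CHd rT rP ;; CTl rP rP ;; cswitch [::
        CMove rA rV ;; cpush 3 ;; CHd rC rP ;; CTl rE rP;
        CHd rA rP ;; CTl rE rP ;;
          CIf rV (CTl rC rA ;; CTl rX rV ;; CFork rE rX rE ;; CHd rX rV ;;
                  CFork rE rX rE)
                 (CHd rC rA);
        CMove rA rV ;; cpush 4 ;; CLeaf rZ ;; CFork rC rZ rP ;; CMove rE rD;
        CFork rV rP rV;
        CMove rE rP ;; CMove rC rV])
      (CLeaf rRun)).

Definition config (c e k v d : tree) (j : seq tree) : seq tree :=
  [:: tbool true, c, e, k, v, d & j].

Inductive msteps (d : tree) :
    nat -> tree -> tree -> tree -> tree -> tree -> tree -> tree -> tree ->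
    Prop :=
  | msteps0 c e k v : msteps d 0 c e k v c e k v
  | mstepsS n c e k v c1 e1 k1 v1 c2 e2 k2 v2 :
      (forall j, 4 < size j -> exists2 j', 4 < size j' &
         crun cstep (config c e k v d j) = config c1 e1 k1 v1 d j') ->
      msteps d n c1 e1 k1 v1 c2 e2 k2 v2 ->
      msteps d n.+1 c e k v c2 e2 k2 v2.

Lemma msteps_trans d n1 n2 c1 e1 k1 v1 c2 e2 k2 v2 c3 e3 k3 v3 :
  msteps d n1 c1 e1 k1 v1 c2 e2 k2 v2 -> msteps d n2 c2 e2 k2 v2 c3 e3 k3 v3 ->
  msteps d (n1 + n2) c1 e1 k1 v1 c3 e3 k3 v3.
Proof.
elim=> // n c e k v c' e' k' v' c'' e'' k'' v'' Hstep _ IH /IH.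
by rewrite addSn; apply: mstepsS.
Qed.

Ltac step :=
  apply: mstepsS;
  [ by move=> [|? [|? [|? [|? [|? ?]]]]] //= _; eexists; last reflexivity
  | ].

Fixpoint weight (e : term) : nat :=
  match e with
  | TVar n => n.+1
  | TLeaf => 1
  | TFork e1 e2 => weight e1 + weight e2 + 3
  | TMatch e e1 e2 => weight e + weight e1 + weight e2 + 2
  | TCall f e => weight e + 3
  end.

Lemma msteps_var d n e k v :
  msteps d n.+1 (enc_term (TVar n)) e k v Leaf (iter n ttl e) k (tget e n).
Proof.
elim: n e => [|n IH] e; first by step; apply: msteps0.
by rewrite iterSr; step; apply: IH.
Qed.

Definition call_weight (defs : seq term) : nat :=
  foldr (fun e w => weight e + w) (size defs).+1 defs.

Lemma call_weightP defs f :
  f < size defs -> weight (nth TLeaf defs f) + f.+1 <= call_weight defs.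
Proof.
move=> fs; have H g (s : seq term) m : g < size s ->
    weight (nth TLeaf s g) + m <= foldr (fun e w => weight e + w) m s.
  elim: s g => [|e s IH] [|g] //=.
    rewrite leq_add2l => _; elim: s {IH} => //= e' s IH.
    exact: leq_trans (leq_addl _ _).
  by rewrite ltnS => /IH /leq_trans; apply; apply: leq_addl.
by apply: leq_trans (H f defs (size defs).+1 fs); rewrite leq_add2l ltnS ltnW.
Qed.

Lemma tget_enc_defs defs f :
  f < size defs -> tget (enc_defs defs) f = enc_term (nth TLeaf defs f).
Proof. by elim: defs f => [|e s IH] [|f] //=; apply: IH. Qed.

Fixpoint calls_ok (m : nat) (e : term) : bool :=
  match e with
  | TFork e1 e2 => calls_ok m e1 && calls_ok m e2
  | TMatch e e1 e2 => [&& calls_ok m e, calls_ok m e1 & calls_ok m e2]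
  | TCall f e => (f < m) && calls_ok m e
  | _ => true
  end.

(** A term is traversed within its weight; every call also pays for fetching a body and for the
    weight of that body. *)
Lemma eval_msteps defs env e v c :
  all (calls_ok (size defs)) defs -> calls_ok (size defs) e ->
  eval defs env e v c ->
  exists2 n, n <= weight e + c * (call_weight defs).+3 &
  forall k v0, exists e', msteps (enc_defs defs) n (enc_term e) env k v0 Leaf e' k v.
Proof.
move=> okd + H; elim: H => {env e v c}.
- move=> env n _; exists n.+1; first by rewrite addn0.
  by move=> k v0; eexists; apply: msteps_var.
- by move=> env _; exists 1 => // k v0; exists env; step; apply: msteps0.
- move=> env e1 e2 v1 v2 c1 c2 _ IH1 _ IH2 /= /andP[/IH1{IH1} [n1 L1 IH1]].
  move=> /IH2{IH2} [n2 L2 IH2].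
  exists (1 + n1 + (1 + n2 + 1)); first by lia.
  move=> k v0.
  have [e1' H1] := IH1 (Fork (Fork (tnat 0) (Fork (enc_term e2) env)) k) v0.
  have [e2' H2] := IH2 (Fork (Fork (tnat 3) v1) k) v1.
  eexists; apply: msteps_trans; first by step; exact: H1.
  apply: msteps_trans; first by step; exact: H2.
  by step; apply: msteps0.
- move=> env e e1 e2 v c1 c2 _ IH1 _ IH2 /= /and3P[/IH1{IH1} [n1 L1 IH1]].
  move=> /IH2{IH2} [n2 L2 IH2] _.
  exists (1 + n1 + (1 + n2)); first by lia.
  move=> k v0.
  have [e1' H1] := IH1 (Fork (Fork (tnat 1)
    (Fork (Fork (enc_term e1) (enc_term e2)) env)) k) v0.
  have [e2' H2] := IH2 k Leaf.
  eexists; apply: msteps_trans; first by step; exact: H1.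
  by step; exact: H2.
- move=> env e e1 e2 a b v c1 c2 _ IH1 _ IH2 /= /and3P[/IH1{IH1} [n1 L1 IH1]].
  move=> _ /IH2{IH2} [n2 L2 IH2].
  exists (1 + n1 + (1 + n2)); first by lia.
  move=> k v0.
  have [e1' H1] := IH1 (Fork (Fork (tnat 1)
    (Fork (Fork (enc_term e1) (enc_term e2)) env)) k) v0.
  have [e2' H2] := IH2 k (Fork a b).
  eexists; apply: msteps_trans; first by step; exact: H1.
  by step; exact: H2.
- move=> env f e v w c1 c2 _ IH1 _ IH2 /= /andP[fs /IH1{IH1} [n1 L1 IH1]].
  have /IH2{IH2}[n2 L2 IH2] : calls_ok (size defs) (nth TLeaf defs f).
    exact: (all_nthP TLeaf okd).
  have := call_weightP fs.
  exists (1 + n1 + (1 + f.+1 + (1 + n2))); first by lia.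
  move=> k v0.
  have [e1' H1] := IH1 (Fork (Fork (tnat 2) (tnat f)) k) v0.
  have [e2' H2] := IH2 k (enc_term (nth TLeaf defs f)).
  eexists; apply: msteps_trans; first by step; exact: H1.
  apply: msteps_trans; first by step; exact: msteps_var.
  by rewrite tget_enc_defs //; step; exact: H2.
Qed.

Lemma represents_eq s r r' :
  nth Leaf r =1 nth Leaf r' -> represents s r -> represents s r'.
Proof. by move=> e [h0 H]; split=> // x; rewrite -e. Qed.

Definition machine_loop : program := While rRun.+1.+4 (compile cstep).

Lemma exec_machine_loop d n c e k v c' e' k' w s j :
  msteps d n c e k v c' e' k' w -> c' = Leaf -> k' = Leaf -> 4 < size j ->
  represents s (config c e k v d j) ->
  exists s' t r, [/\ exec machine_loop s t s', represents s' r,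
    nth Leaf r rV = w & t <= n.+1 * (ctime cstep).+1 + 1].
Proof.
move=> H; elim: H s j => {n c e k v c' e' k' w}.
  move=> c e k v s j -> -> sj Hs.
  have [s' [t [E R _ L]]] := exec_compile cstep Hs.
  exists s', (t + 1).+1, [:: Leaf, Leaf, e, Leaf, v, d & j]; split=> //.
    apply: exec_WhileT E _; first by case: Hs => _ /(_ 0) /=; case: reg => //=; case.
    by apply: exec_WhileF; case: R => _ /(_ 0).
  by rewrite mul1n; lia.
move=> n c e k v c1 e1 k1 v1 c2 e2 k2 v2 Hstep _ IH s j Ec Ek sj Hs.
have [s1 [t1 [E1 R1 _ L1]]] := exec_compile cstep Hs.
have [j' sj' e'] := Hstep _ sj; rewrite e' in R1.
have [s2 [t2 [r [E2 R2 V2 L2]]]] := IH _ _ Ec Ek sj' R1.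
exists s2, (t1 + t2).+1, r; split=> //.
  by apply: exec_WhileT E1 E2; case: Hs => _ /(_ 0) /=; case: reg => //=; case.
by rewrite mulSn; lia.
Qed.

(** * Reading the input *)

(* The input is scanned from its end; [rE] holds the list under construction
   and [rK] the stack of the enclosing ones. *)
Definition cread (a : symbol) : cmd :=
  match a with
  | SBit true | SSign true | SQuant Exists =>
      CLeaf rT ;; CFork rT rT rT ;; CFork rE rT rE
  | SBit false | SSign false | SQuant Forall => CLeaf rT ;; CFork rE rT rE
  | SOpen => CHd rT rK ;; CTl rK rK ;; CFork rE rE rT
  | SClose => CFork rK rE rK ;; CLeaf rE
  end.

Definition tread (a : symbol) (ek : tree * tree) : tree * tree :=
  match a with
  | SBit b | SSign b => (Fork (tbool b) ek.1, ek.2)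
  | SQuant q => (Fork (tbool (is_exists q)) ek.1, ek.2)
  | SOpen => (Fork ek.1 (thd ek.2), ttl ek.2)
  | SClose => (Leaf, Fork ek.1 ek.2)
  end.

Definition reading (ek : tree * tree) (x : tree) : seq tree :=
  [:: Leaf; Leaf; ek.1; ek.2; Leaf; Leaf; x].

Lemma crun_cread w ek x :
  exists x', foldr (fun a => crun (cread a)) (reading ek x) w =
             reading (foldr tread ek w) x'.
Proof.
elim: w => [|a w [x' /= ->]]; first by exists x.
by case: a => [[]|[]|[]||] /=; eexists.
Qed.

Definition symbols : seq symbol :=
  [:: SBit false; SBit true; SSign false; SSign true; SQuant Exists;
      SQuant Forall; SOpen; SClose].

Fixpoint switch (cs : seq cmd) : program :=
  match cs with
  | [::] => Skip
  | [:: c] => compile c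
  | c :: cs' => Seq (Pred 2 2) (If 2 (switch cs') (compile c))
  end.

Fixpoint switch_time (cs : seq cmd) : nat :=
  if cs is c :: cs' then ctime c + switch_time cs' + 2 else 0.

Lemma exec_switch cs i s r :
  represents s r -> i < size cs -> reg s 2 = i.+1 ->
  exists s' t, [/\ exec (switch cs) s t s',
    represents s' (crun (nth (CLeaf 0) cs i) r), extends s s'
    & t <= switch_time cs].
Proof.
elim: cs i s => // c [|c' cs] IH [|i] s Hs // ics e2.
- have [s' [t [E R X L]]] := exec_compile c Hs.
  by exists s', t; split=> //=; lia.
- have Hs' : represents (set_reg s 2 0) r by [].
  have [s' [t [E R X L]]] := exec_compile c Hs'.
  exists s', (1 + t.+1); split=> //; last by rewrite /=; lia.
  apply: exec_Seq; first by apply: exec_Pred.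
  by rewrite e2; apply: exec_IfF.
- have Hs' : represents (set_reg s 2 i.+1) r by [].
  have [||s' [t [E R X L]]] := IH i _ Hs' => //.
  exists s', (1 + t.+1); split=> //; last by rewrite /= in L *; lia.
  apply: exec_Seq; first by apply: exec_Pred.
  by rewrite e2; apply: exec_IfT.
Qed.

(** Leaves the address of the end marker in register 1. It is the length of the input and also the
    first free cell, so that the heap grows behind the input. *)
Definition scan : program :=
  Seq (Read 2 1) (While 2 (Seq (Succ 1 1) (Read 2 1))).

Definition read_loop : program :=
  While 3 (Seq (Pred 3 3) (Seq (Read 2 3) (switch (map cread symbols)))).

Definition read_time : nat := (switch_time (map cread symbols)).+3.

Lemma symbol_code_nth a :
  exists2 i, i < size symbols &
  symbol_code a = i.+1 /\ nth (CLeaf 0) (map cread symbols) i = cread a.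
Proof.
case: a => [[]|[]|[]||]; [exists 1|exists 0|exists 3|exists 2|exists 4|exists 5
  |exists 6|exists 7]; done.
Qed.

Lemma exec_scan w :
  exists s' t, [/\ exec scan (init_state w) t s', reg s' 1 = size w,
    forall x, reg s' x.+3 = 0, memory s' = nth 0 (map symbol_code w)
    & t <= 3 * size w + 2].
Proof.
set m := nth 0 _.
have H k s : reg s 1 + k = size w -> reg s 2 = m (reg s 1) -> memory s = m ->
  (forall x, reg s x.+3 = 0) ->
  exists s' t, [/\ exec (While 2 (Seq (Succ 1 1) (Read 2 1))) s t s',
    reg s' 1 = size w, forall x, reg s' x.+3 = 0, memory s' = m & t <= 3 * k + 1].
  elim: k s => [|k IH] s Hk H2 Hm H0.
    exists s, 1; split=> //; last by rewrite -Hk addn0.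
    by apply: exec_WhileF; rewrite H2 /m nth_default // size_map -Hk addn0.
  set s1 := set_reg (set_reg s 1 (reg s 1).+1) 2 (m (reg s 1).+1).
  have [||||s' [t [E R1 R0 M L]]] := IH s1; rewrite /s1 /upd //=.
    by rewrite -Hk /upd /=; lia.
  exists s', (1 + 1 + t).+1; split=> //; last by lia.
  apply: exec_WhileT E.
    rewrite H2 /m (nth_map SOpen) ?lt0n; last by rewrite -Hk; lia.
    by have [i _ [-> _]] := symbol_code_nth (nth SOpen w (reg s 1)).
  apply: exec_Seq; first exact: exec_Succ.
  by rewrite /s1 -Hm; apply: exec_Read.
have [||||s' [t [E R1 R0 M L]]] := H (size w) (set_reg (init_state w) 2 (m 0)) => //.
exists s', (1 + t); split=> //; last by lia.
apply: exec_Seq E; exact: exec_Read.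
Qed.

Lemma exec_read_loop w i s r :
  represents s r -> reg s 3 = i -> i <= size w -> size w <= reg s 1 ->
  (forall j, j < size w -> memory s j = nth 0 (map symbol_code w) j) ->
  exists s' t, [/\ exec read_loop s t s',
    represents s' (foldr (fun a => crun (cread a)) r (take i w))
    & t <= i * read_time + 1].
Proof.
elim: i s r => [|i IH] s r Hs e3 iw ws Hm.
  by exists s, 1; rewrite take0; split=> //; apply: exec_WhileF.
have [k kl [ea ec]] := symbol_code_nth (nth SOpen w i).
pose s1 := set_reg (set_reg s 3 i) 2 k.+1.
have Hs1 : represents s1 r by [].
have [||s2 [t2 [E2 R2 [X3 X1 Xm] L2]]] := exec_switch Hs1 (cs :=
  map cread symbols) (i := k) => //.
have [|||j jw|s3 [t3 [E3 R3 L3]]] := IH _ _ R2.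
- by rewrite X3.
- exact: ltnW.
- exact: leq_trans X1.
- by rewrite Xm ?Hm //; apply: leq_trans ws.
exists s3, (1 + (1 + t2) + t3).+1; split.
- apply: exec_WhileT E3; first by rewrite e3.
  apply: exec_Seq; first exact: exec_Pred.
  apply: exec_Seq; first exact: exec_Read.
  by rewrite /set_reg /= /upd /= e3 Hm // (nth_map SOpen) // ea.
- by rewrite (take_nth SOpen) // -cats1 foldr_cat /= -ec.
- by rewrite mulSn /read_time; move: L2 L3; rewrite /read_time; lia.
Qed.

Definition setup (defs : seq term) (main : term) : cmd :=
  cbuild 11 (enc_defs defs) ;; CMove rD 11 ;; cbuild 11 (enc_term main) ;;
  CMove rC 11 ;; CLeaf rRun ;; CFork rRun rRun rRun.

Definition run_main (defs : seq term) (main : term) : program :=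
  Seq scan (Seq (Move 3 1) (Seq read_loop (Seq (compile (setup defs main))
    (Seq machine_loop (If rV.+1.+4 (Const 0 1) (Const 0 0)))))).

Definition overhead (defs : seq term) (main : term) : nat :=
  3 + 1 + read_time + ctime (setup defs main) +
  (weight main + (call_weight defs).+3 + 1) * (ctime cstep).+1 + 10.

Lemma crun_setup defs main e x :
  exists2 j, 4 < size j &
  nth Leaf (crun (setup defs main) (reading (e, Leaf) x)) =1
  nth Leaf (config (enc_term main) e Leaf Leaf (enc_defs defs) j).
Proof.
rewrite /=; set r1 := reading _ _.
have [a1 b1] := crun_cbuild 11 (enc_defs defs) r1; set r2 := crun _ r1 in a1 b1 *.
set r3 := set_nth _ r2 _ _.
have [a2 b2] := crun_cbuild 11 (enc_term main) r3; set r4 := crun _ r3 in a2 b2 *.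
set r5 := set_nth _ (set_nth _ _ _ _) _ _.
exists (drop 6 (r5 ++ nseq 11 Leaf)); first by rewrite size_drop size_cat size_nseq; lia.
have H : nth Leaf r5 =1 nth Leaf (r5 ++ nseq 11 Leaf).
  move=> y; rewrite nth_cat; case: ltnP => // le.
  by rewrite nth_default // nth_nseq; case: ifP.
have E y : nth Leaf r5 y = if y == 0 then tbool true else
    if y == rC then enc_term main else nth Leaf r4 y.
  by rewrite /r5 a2; case: y => [|[|y]]; do 3?[rewrite nth_set_nth /=].
have R y : y < 11 -> nth Leaf r4 y = if y == rD then enc_defs defs else nth Leaf r1 y.
  by move=> ly; rewrite b2 // /r3 nth_set_nth /= a1; case: ifP => // _; rewrite b1.
move=> y; rewrite /config.
case: y => [|[|[|[|[|[|y]]]]]]; try by rewrite E ?R.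
by rewrite H /= nth_drop.
Qed.

Lemma run_mainP defs main w input b c :
  all (calls_ok (size defs)) defs -> calls_ok (size defs) main -> 0 < size w ->
  foldr tread (Leaf, Leaf) w = (input, Leaf) ->
  eval defs input main (tbool b) c ->
  exists2 t, outputs (run_main defs main) w t b
           & t <= overhead defs main * (size w + c).
Proof.
move=> okd okm w0 Hw Hev.
have [s1 [t1 [E1 R1 R0 M1 L1]]] := exec_scan w.
pose s2 := set_reg s1 3 (size w).
have Hs2 : represents s2 (reading (Leaf, Leaf) Leaf).
  split=> [|x]; first by rewrite /= /upd /= R1.
  by rewrite /= /upd /= R0; case: x => [|[|[|[|[|[|[|x]]]]]]] //=; rewrite nth_nil.
have [||||s3 [t3 [E3 R3 L3]]] := exec_read_loop Hs2 (w := w) (i := size w) => //.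
- by rewrite /= /upd /= R1.
- by rewrite /= M1.
rewrite take_size in R3; have [x e3] := crun_cread w (Leaf, Leaf) Leaf.
rewrite e3 Hw in R3.
have [s4 [t4 [E4 R4 _ L4]]] := exec_compile (setup defs main) R3.
have [j sj Hj] := crun_setup defs main input x.
have {R4}R4 := represents_eq Hj R4.
have [n Ln Hn] := eval_msteps okd okm Hev.
have [e' {}Hn] := Hn Leaf Leaf.
have [s5 [t5 [r [E5 R5 V5 L5]]]] := exec_machine_loop Hn erefl erefl sj R4.
have P5 : points_to (memory s5) (reg s5 1) (reg s5 rV.+1.+4) (tbool b).
  by rewrite -V5; case: R5.
pose s6 := set_reg s5 0 b.
have E6 : exec (If rV.+1.+4 (Const 0 1) (Const 0 0)) s5 2 s6.
  case: b {Hev Hn V5} P5 @s6 => /=; last first.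
    by move=> P5; apply: exec_IfF => //; apply: exec_Const.
  by case=> p0 _ _ _; apply: exec_IfT; rewrite -?lt0n //; apply: exec_Const.
exists (t1 + (1 + (t3 + (t4 + (t5 + 2))))).
  exists s6; split=> //.
  apply: exec_Seq E1 _; apply: exec_Seq.
    by apply: exec_Move.
  rewrite R1; apply: exec_Seq E3 _; apply: exec_Seq E4 _.
  by apply: exec_Seq E5 E6.
rewrite /overhead.
have : n.+1 <= (weight main + (call_weight defs).+3 + 1) * (size w + c).
  by apply: leq_ltn_trans Ln _; rewrite !mulnDl; nia.
set A := weight main + _ + 1; set C := (ctime cstep).+1 in L5 *.
move=> Ln'; have : n.+1 * C <= A * C * (size w + c).
  by rewrite mulnAC leq_mul2r Ln' orbT.
move: L1 L3 L4 L5; set B := ctime _; set D := read_time.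
move: (A * C) (n.+1 * C) => AC nC.
have : B <= B * (size w + c) by rewrite leq_pmulr // addn_gt0 w0.
rewrite !mulnDl [size w * D]mulnC; nia.
Qed.

(** * Names of variables and the input as a tree *)

Definition tname (x : nat) : tree := locked (tlist (map tbool (bits x))).

Lemma tlist_inj : injective tlist.
Proof. by elim=> [|a s IH] [|b r] //= [-> /IH ->]. Qed.

Lemma bits_inj : injective bits.
Proof.
suff H k x y : x < 2 ^ k -> y < 2 ^ k ->
    (forall i, odd (x %/ 2 ^ i) = odd (y %/ 2 ^ i)) -> x = y.
  have odd_bits n i : odd (n %/ 2 ^ i) = nth false (bits n) i.
    rewrite /bits; case: (ltnP i (trunc_log 2 n).+1) => hi; first by rewrite nth_mkseq.
    rewrite nth_default ?size_mkseq // divn_small //.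
    by apply: leq_trans (trunc_log_ltn n (isT : 1 < 2)) _; rewrite leq_exp2l.
  move=> x y e; apply: (H (maxn x y)).
  - by apply: leq_ltn_trans (leq_maxl x y) _; apply: ltn_expl.
  - by apply: leq_ltn_trans (leq_maxr x y) _; apply: ltn_expl.
  - by move=> i; rewrite !odd_bits e.
elim: k x y => [|k IH] x y; first by rewrite expn0 !ltnS !leqn0 => /eqP-> /eqP->.
move=> hx hy e; rewrite -(odd_double_half x) -(odd_double_half y).
have := e 0; rewrite expn0 !divn1 => ->; congr (_ + _.*2).
apply: IH => [||i].
- by rewrite ltn_half_double -mul2n -expnS.
- by rewrite ltn_half_double -mul2n -expnS.
- by have := e i.+1; rewrite expnS !divnMA !divn2.
Qed.

Lemma tname_inj : injective tname.
Proof.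
by rewrite /tname => x y; rewrite -!lock => /tlist_inj/inj_map => /(_ _)/bits_inj;
  apply; case=> [] [].
Qed.

(** There is at least one digit, so a name is never a leaf. A leaf in its place can therefore mark
    an alternation among the items and a set among the types. *)
Lemma tname_fork x : tname x = Fork (thd (tname x)) (ttl (tname x)).
Proof. by rewrite /tname -lock. Qed.

(** Peeling off the first child turns a node with several children into a chain of binary joins at
    the same bag; [ftype] recurses in the same way. *)
Fixpoint tdec_ind2 (P : tdec -> Prop) (H0 : forall b, P (TNode b [::]))
    (H1 : forall b t ts, P t -> P (TNode b ts) -> P (TNode b (t :: ts)))
    (T : tdec) : P T :=
  let: TNode b ts := T in
  (fix aux ts : P (TNode b ts) :=
     if ts is t :: ts' then H1 b t ts' (tdec_ind2 H0 H1 t) (aux ts')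
     else H0 b) ts.

Definition bag (T : tdec) : seq nat := let: TNode b _ := T in b.
Definition kids (T : tdec) : seq tdec := let: TNode _ ts := T in ts.

Definition tnames (s : seq nat) : tree := tlist (map tname s).
Definition tliteral (l : literal) : seq tree := [:: tbool l.1; tname l.2].
Definition tclause (c : seq literal) : tree := tlist (flatten (map tliteral c)).
Definition tmatrix (m : seq (seq literal)) : tree := tlist (map tclause m).
Definition tblock (Qi : quantifier * seq nat) : seq tree :=
  [:: tbool (is_exists Qi.1); tnames Qi.2].
Definition tblocks (bl : seq (quantifier * seq nat)) : tree :=
  tlist (flatten (map tblock bl)).
Fixpoint tchildren (T : tdec) : tree :=
  let: TNode _ ts := T in
  tlist (flatten (map (fun t => [:: tnames (bag t); tchildren t]) ts)).

Definition tinput (psi : qbf) (T : tdec) : tree :=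
  tlist [:: tblocks (qblocks psi); tmatrix (qmatrix psi); tnames (bag T);
            tchildren T].

Lemma tread_brackets w v e k :
  foldr tread (Leaf, Fork e k) w = (v, Fork e k) ->
  foldr tread (e, k) (SOpen :: w ++ [:: SClose]) = (Fork v e, k).
Proof. by move=> H; rewrite /= foldr_cat /= H. Qed.

Lemma tread_nat n e k : foldr tread (e, k) (enc_nat n) = (Fork (tname n) e, k).
Proof.
apply: tread_brackets; rewrite /tname -lock.
by elim: (bits n) => //= b s ->.
Qed.

Lemma tread_seq (A : Type) (enc : A -> seq symbol) (its : A -> seq tree) s e k :
  (forall a e k, foldr tread (e, k) (enc a) = (foldr Fork e (its a), k)) ->
  foldr tread (e, k) (enc_seq enc s) =
  (Fork (tlist (flatten (map its s))) e, k).
Proof.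
move=> H; apply: tread_brackets.
by elim: s => //= a s IH; rewrite foldr_cat IH H /tlist foldr_cat.
Qed.

Lemma flatten_seq1 (A B : Type) (f : A -> B) s :
  flatten [seq [:: f a] | a <- s] = map f s.
Proof. by elim: s => //= a s ->. Qed.

Lemma tread_names s e k :
  foldr tread (e, k) (enc_seq enc_nat s) = (Fork (tnames s) e, k).
Proof.
rewrite (@tread_seq _ _ (fun x => [:: tname x])) ?flatten_seq1 //.
exact: tread_nat.
Qed.

Lemma tread_tdec T e k :
  foldr tread (e, k) (enc_tdec T) =
  (Fork (tnames (bag T)) (Fork (tchildren T) e), k).
Proof.
pose its t := [:: tnames (bag t); tchildren t].
suff H T' : forall e k, foldr tread (e, k) (flatten (map enc_tdec (kids T'))) =
    (foldr Fork e (flatten (map its (kids T'))), k).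
  case: T => b ts;
    rewrite -[enc_tdec _]/(enc_seq enc_nat b ++ enc_seq enc_tdec ts) foldr_cat.
  by rewrite (tread_brackets (H (TNode b ts) _ _)) tread_names.
elim/tdec_ind2: T' => {T e k} [//|b [b' ts'] ts IH1 IH2 e k].
rewrite -[flatten _]/((enc_seq enc_nat b' ++ enc_seq enc_tdec ts') ++ flatten (map enc_tdec ts)).
rewrite !foldr_cat IH2.
by rewrite (tread_brackets (IH1 _ _)) tread_names.
Qed.

Lemma tread_input psi T :
  foldr tread (Leaf, Leaf) (enc_qbf psi ++ enc_tdec T) = (tinput psi T, Leaf).
Proof.
rewrite foldr_cat tread_tdec /enc_qbf foldr_cat.
rewrite (@tread_seq _ _ (fun c => [:: tclause c])); last first.
  move=> c e k; rewrite (@tread_seq _ _ tliteral) // => {c e k} l e k.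
  by rewrite -[enc_literal l]/([:: SSign l.1] ++ enc_nat l.2) foldr_cat tread_nat.
rewrite (@tread_seq _ _ tblock); last first.
  case=> q s e k.
  by rewrite -[enc_block _]/([:: SQuant q] ++ enc_seq enc_nat s) foldr_cat tread_names.
by rewrite /tinput flatten_seq1.
Qed.

(** * Cost analysis by weakest preconditions *)

Section Wp.
Variable defs : seq term.

Definition computes (f : nat) (v w : tree) (d : nat) : Prop :=
  exists2 d', d' <= d & eval defs v (nth TLeaf defs f) w d'.

(** Symbolic execution: simplifying [wp] runs a body up to its next call, where the value and an
    upper bound on the cost of the callee are supplied. *)
Fixpoint wp (e : term) (env : tree) (Q : tree -> nat -> Prop) : Prop :=
  match e with
  | TVar n => Q (tget env n) 0
  | TLeaf => Q Leaf 0
  | TFork e1 e2 =>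
      wp e1 env (fun v1 c1 => wp e2 env (fun v2 c2 => Q (Fork v1 v2) (c1 + c2)))
  | TMatch e e1 e2 =>
      wp e env (fun v c =>
        match v with
        | Leaf => wp e1 env (fun w d => Q w (c + d))
        | Fork a b => wp e2 (Fork a (Fork b env)) (fun w d => Q w (c + d))
        end)
  | TCall f e =>
      wp e env (fun v c => exists w d, computes f v w d /\ Q w (c + d).+1)
  end.

Lemma wp_sound e env Q :
  wp e env Q -> exists v c c', [/\ eval defs env e v c', c' <= c & Q v c].
Proof.
elim: e env Q => [n|| e1 IH1 e2 IH2|e IH e1 IH1 e2 IH2|f e IH]
  env Q /=.
- by exists (tget env n), 0, 0; split=> //; apply: eval_Var.
- by exists Leaf, 0, 0; split=> //; apply: eval_Leaf.
- case/IH1 => v1 [c1 [c1' [E1 L1 /IH2 [v2 [c2 [c2' [E2 L2 H]]]]]]].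
  exists (Fork v1 v2), (c1 + c2), (c1' + c2'); split=> //; last exact: leq_add.
  exact: eval_Fork.
- case/IH => [[|a b]] [c1 [c1' [E1 L1]]].
    case/IH1 => v2 [c2 [c2' [E2 L2 H]]].
    exists v2, (c1 + c2), (c1' + c2'); split=> //; last exact: leq_add.
    exact: eval_MatchLeaf.
  case/IH2 => v2 [c2 [c2' [E2 L2 H]]].
  exists v2, (c1 + c2), (c1' + c2'); split=> //; last exact: leq_add.
  exact: eval_MatchFork E2.
- case/IH => v1 [c1 [c1' [E1 L1 [w [d [[d' ld E2] H]]]]]].
  exists w, (c1 + d).+1, (c1' + d').+1; split=> //; last by rewrite ltnS leq_add.
  exact: eval_Call E2.
Qed.

Lemma wp_runs f v w d :
  wp (nth TLeaf defs f) v (fun w' c => w' = w /\ c <= d) -> computes f v w d.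
Proof.
case/wp_sound => w' [c [c' [E L [<- Lc]]]].
by exists c' => //; apply: leq_trans Lc.
Qed.

Lemma runs_leq f v w d d' : computes f v w d -> d <= d' -> computes f v w d'.
Proof. by case=> c lc E le; exists c => //; apply: leq_trans le. Qed.
End Wp.

(** * Sets of trees as increasing lists *)

Definition tEQ : tree := Leaf.
Definition tLT : tree := Fork Leaf Leaf.
Definition tGT : tree := Fork (Fork Leaf Leaf) Leaf.

Fixpoint tcmp (x y : tree) : tree :=
  match x, y with
  | Leaf, Leaf => tEQ
  | Leaf, Fork _ _ => tLT
  | Fork _ _, Leaf => tGT
  | Fork a b, Fork c d => if tcmp a c is Leaf then tcmp b d else tcmp a c
  end.

Lemma tcmp_cases x y : [\/ tcmp x y = tEQ, tcmp x y = tLT | tcmp x y = tGT].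
Proof.
elim: x y => [|a IHa b IHb] [|c d] /=; [by constructor 1|by constructor 2
  |by constructor 3|].
by case: (IHa c) => ->; [apply: IHb | constructor 2 | constructor 3].
Qed.

Lemma tcmp_eq x y : tcmp x y = tEQ <-> x = y.
Proof.
split=> [|->]; last by elim: y => //= a -> b ->.
elim: x y => [|a IHa b IHb] [|c d] //=.
by case: (tcmp_cases a c) => e; rewrite e // => /IHb ->; rewrite (IHa _ e).
Qed.

Definition tree_eqb (x y : tree) : bool := if tcmp x y is Leaf then true else false.

Lemma tree_eqP : Equality.axiom tree_eqb.
Proof.
move=> x y; rewrite /tree_eqb; apply: (iffP idP) => [|->].
  by case e: (tcmp x y) => // _; apply/tcmp_eq.
by have /tcmp_eq -> : y = y by [].
Qed.

HB.instance Definition _ := hasDecEq.Build tree tree_eqP.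

Definition tlt (x y : tree) : bool := tcmp x y == tLT.

Lemma tlt_irr : irreflexive tlt.
Proof. by move=> x; rewrite /tlt; have /tcmp_eq -> : x = x by []. Qed.

Lemma tcmp_gt x y : tcmp x y = tGT <-> tcmp y x = tLT.
Proof.
split; elim: x y => [|a IHa b IHb] [|c d] //=.
  case: (tcmp_cases a c) => e; rewrite e //; last by rewrite (IHa _ e).
  by move=> /IHb; move/tcmp_eq: e => ->; have /tcmp_eq -> : c = c by [].
case: (tcmp_cases c a) => e; rewrite e //; last by rewrite (IHa _ e).
by move=> /IHb; move/tcmp_eq: e => ->; have /tcmp_eq -> : a = a by [].
Qed.

Lemma tlt_trans : transitive tlt.
Proof.
move=> y x z /eqP + /eqP + ; rewrite /tlt => + + ; move=> h1 h2; apply/eqP; move: h1 h2.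
elim: y x z => [|a IHa b IHb] [|c d] [|e f] //=.
case: (tcmp_cases c a) => e1; rewrite e1 //; case: (tcmp_cases a e) => e2; rewrite e2 //.
- move/tcmp_eq: e1 => ->; rewrite e2 /=; exact: IHb.
- by move/tcmp_eq: e1 => ->; rewrite e2.
- by move/tcmp_eq: e2 => <-; rewrite e1.
- by rewrite (IHa _ _ e1 e2).
Qed.

Fixpoint tins (x : tree) (s : seq tree) : seq tree :=
  if s is y :: s' then
    match tcmp x y with
    | Leaf => s
    | Fork Leaf _ => x :: s
    | Fork (Fork _ _) _ => y :: tins x s'
    end
  else [:: x].

Definition tuni (s s' : seq tree) : seq tree := foldr tins s' s.
Definition tcanon (s : seq tree) : seq tree := tuni s [::].

Lemma mem_tins x s : tins x s =i x :: s.
Proof.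
elim: s => //= y s IH z.
case: (tcmp_cases x y) => e; rewrite e //.
  by move/tcmp_eq: e => ->; rewrite !inE orbA orbb.
by rewrite !inE IH inE orbCA.
Qed.

Lemma tins_sorted x s : sorted tlt s -> sorted tlt (tins x s).
Proof.
rewrite !(sorted_pairwise tlt_trans).
elim: s => //= y s IH /andP[ys ss].
case: (tcmp_cases x y) => e; rewrite e /= ?ys ?ss //=.
  rewrite /tlt e eqxx !andbT; apply/allP=> z /(allP ys) yz.
  by apply: tlt_trans yz; rewrite /tlt e.
rewrite IH // andbT; apply/allP=> z; rewrite mem_tins inE.
case/orP => [/eqP ->|]; last exact: (allP ys).
by rewrite /tlt; move/tcmp_gt: e => ->.
Qed.

Lemma mem_tuni s s' : tuni s s' =i s ++ s'.
Proof. by elim: s => //= x s IH z; rewrite mem_tins !inE IH. Qed.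

Lemma tuni_sorted s s' : sorted tlt s' -> sorted tlt (tuni s s').
Proof. by move=> h; elim: s => //= x s IH; apply: tins_sorted. Qed.

Lemma mem_tcanon s : tcanon s =i s.
Proof. by move=> z; rewrite mem_tuni cats0. Qed.

Lemma tcanon_sorted s : sorted tlt (tcanon s).
Proof. exact: tuni_sorted. Qed.

(** Extensionality: thanks to the canonical lists, the laws of the operations on types are equations
    between trees. *)
Lemma tset_eq s s' : sorted tlt s -> sorted tlt s' -> s =i s' -> s = s'.
Proof. exact: irr_sorted_eq tlt_trans tlt_irr _ _. Qed.

Lemma tset_uniq s : sorted tlt s -> uniq s.
Proof. exact: sorted_uniq tlt_trans tlt_irr _. Qed.

(** * Types of partial assignments *)

(* A prefix is a list of items: [Some x] is the variable x and [None] an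
   alternation of the quantifiers. A type is a decision tree over the variables
   of the first block whose leaves are the sets of the types of the remaining
   blocks; after the last block the set is {unit} or empty, according to the
   truth value. *)
Definition tset (s : seq tree) : tree := Fork Leaf (tlist s).
Definition tnode (x : nat) (l r : tree) : tree := Fork (tname x) (Fork l r).
Definition tunit : tree := tset [::].

Fixpoint tseq (t : tree) : seq tree := if t is Fork a b then a :: tseq b else [::].
Definition elems (u : tree) : seq tree := tseq (ttl u).
Definition vleft (u : tree) : tree := thd (ttl u).
Definition vright (u : tree) : tree := ttl (ttl u).

Lemma tlistK : cancel tlist tseq.
Proof. by elim=> //= a s ->. Qed.

Lemma elems_tset s : elems (tset s) = s.
Proof. exact: tlistK. Qed.

Definition items := seq (option nat).

Fixpoint has_shape (L : items) (u : tree) : Prop :=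
  match L with
  | [::] => exists s, [/\ u = tset s, sorted tlt s & {subset s <= [:: tunit]}]
  | Some x :: L' => exists l r, [/\ u = tnode x l r, has_shape L' l & has_shape L' r]
  | None :: L' =>
      exists s, [/\ u = tset s, sorted tlt s & forall e, e \in s -> has_shape L' e]
  end.

Fixpoint vunion (L : items) (u v : tree) : tree :=
  match L with
  | Some x :: L' =>
      tnode x (vunion L' (vleft u) (vleft v)) (vunion L' (vright u) (vright v))
  | _ => tset (tuni (elems u) (elems v))
  end.

(** At [z] the two branches are united whatever the quantifier of [z]: everything that either value
    can reach is kept, and choosing is left to the final evaluation. *)
Fixpoint vforget (z : nat) (L : items) (u : tree) : tree :=
  match L with
  | [::] => tset (tcanon [seq tunit | _ <- elems u])
  | Some x :: L' =>
      if z == x then vunion L' (vleft u) (vright u)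
      else tnode x (vforget z L' (vleft u)) (vforget z L' (vright u))
  | None :: L' => tset (tcanon [seq vforget z L' e | e <- elems u])
  end.

Definition tests (x : nat) (v : tree) : bool := tname x == thd v.

(** The bag variables of [v] are meant to be among those of [u]; a variable that [v] does not test
    sends [v] unchanged into both branches. *)
Fixpoint vjoin (L : items) (u v : tree) : tree :=
  match L with
  | [::] => tset (tcanon [seq tunit | _ <- elems u, _ <- elems v])
  | Some x :: L' =>
      if tests x v
      then tnode x (vjoin L' (vleft u) (vleft v)) (vjoin L' (vright u) (vright v))
      else tnode x (vjoin L' (vleft u) v) (vjoin L' (vright u) v)
  | None :: L' =>
      tset (tcanon [seq vjoin L' d e | d <- elems u, e <- elems v])
  end.

Definition restrict (b : pred nat) (L : items) : items :=
  [seq i <- L | if i is Some x then b x else true].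

Definition ivars (L : items) : seq nat := pmap id L.

Lemma mem_ivars x L : (x \in ivars L) = (Some x \in L).
Proof. by elim: L => //= [[y|]] L IH; rewrite !inE IH. Qed.

Lemma ivars_restrict b L : ivars (restrict b L) = filter b (ivars L).
Proof. by elim: L => //= [[x|]] L //= <-; case: (b x). Qed.

(* The type of phi at a, when the variables in b are still free and those in I
   are projected away; the other variables do not occur in phi. *)
Fixpoint sem (b I : pred nat) (phi : (nat -> bool) -> bool) (L : items)
    (a : nat -> bool) : tree :=
  match L with
  | [::] => tset (if phi a then [:: tunit] else [::])
  | None :: L' => tset [:: sem b I phi L' a]
  | Some x :: L' =>
      let l := sem b I phi L' (assign a x false) in
      let r := sem b I phi L' (assign a x true) in
      if b x then tnode x l r
      else if I x then vunion (restrict b L') l r else sem b I phi L' a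
  end.

Lemma vunion_shape L u v : has_shape L u -> has_shape L v -> has_shape L (vunion L u v).
Proof.
elim: L u v => [|[x|] L IH] u v /=.
- case=> [s [-> ss us]] [t [-> st ut]]; rewrite !elems_tset.
  exists (tuni s t); split=> // [|e]; first exact: tuni_sorted.
  by rewrite mem_tuni mem_cat => /orP[/us|/ut].
- case=> [l [r [-> sl sr]]] [l' [r' [-> sl' sr']]].
  by eexists; eexists; split; [reflexivity|apply: IH|apply: IH].
- case=> [s [-> ss us]] [t [-> st ut]]; rewrite !elems_tset.
  exists (tuni s t); split=> // [|e]; first exact: tuni_sorted.
  by rewrite mem_tuni mem_cat => /orP[/us|/ut].
Qed.

Lemma tuniC s t : sorted tlt s -> sorted tlt t -> tuni s t = tuni t s.
Proof.
move=> ss st; apply: tset_eq; rewrite ?tuni_sorted // => e.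
by rewrite !mem_tuni !mem_cat orbC.
Qed.

Lemma tuniA s t r : sorted tlt r -> tuni s (tuni t r) = tuni (tuni s t) r.
Proof.
move=> sr; apply: tset_eq; rewrite ?tuni_sorted // => e.
by rewrite !(mem_tuni, mem_cat) orbA.
Qed.

Lemma vunionC L u v : has_shape L u -> has_shape L v -> vunion L u v = vunion L v u.
Proof.
elim: L u v => [|[x|] L IH] u v /=.
- by case=> [s [-> ss us]] [t [-> st ut]]; rewrite !elems_tset tuniC.
- case=> [l [r [-> sl sr]]] [l' [r' [-> sl' sr']]]; congr tnode; exact: IH.
- by case=> [s [-> ss us]] [t [-> st ut]]; rewrite !elems_tset tuniC.
Qed.

Lemma vunionA L u v w : has_shape L u -> has_shape L v -> has_shape L w ->
  vunion L u (vunion L v w) = vunion L (vunion L u v) w.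
Proof.
elim: L u v w => [|[x|] L IH] u v w /=.
- by case=> s [-> ? _] [t [-> ? _]] [r [-> ? _]]; rewrite !elems_tset tuniA.
- case=> l [r [-> sl sr]] [l' [r' [-> sl' sr']]] [l2 [r2 [-> sl2 sr2]]].
  by congr tnode; apply: IH.
- by case=> s [-> ? _] [t [-> ? _]] [r [-> ? _]]; rewrite !elems_tset tuniA.
Qed.

Lemma vunionACA L u v w z : has_shape L u -> has_shape L v -> has_shape L w ->
  has_shape L z ->
  vunion L (vunion L u v) (vunion L w z) = vunion L (vunion L u w) (vunion L v z).
Proof.
move=> su sv sw sz.
rewrite -(vunionA su sv (vunion_shape sw sz)) (vunionA sv sw sz) (vunionC sv sw).
by rewrite -(vunionA sw sv sz) (vunionA su sw (vunion_shape sv sz)).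
Qed.

Lemma sem_shape b I phi L a : has_shape (restrict b L) (sem b I phi L a).
Proof.
elim: L a => [|[x|] L IH] a /=.
- by exists (if phi a then [:: tunit] else [::]); case: (phi a); split.
- case: (b x); first by eexists; eexists; split; [reflexivity|exact: IH|exact: IH].
  by case: (I x); [apply: vunion_shape | exact: IH].
- by exists [:: sem b I phi L a]; split=> // e; rewrite inE => /eqP ->.
Qed.

Lemma sem_ext b I phi psi L a a' :
  (forall c c', (forall x, b x || I x -> c x = c' x) -> phi c = psi c') ->
  (forall x, b x || I x -> Some x \notin L -> a x = a' x) ->
  sem b I phi L a = sem b I psi L a'.
Proof.
move=> Hphi; elim: L a a' => [|[x|] L IH] a a' Ha /=.
- by rewrite (Hphi a a') // => x Hx; apply: Ha.
- have Hass v : sem b I phi L (assign a x v) = sem b I psi L (assign a' x v).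
    apply: IH => y Hy nL; rewrite /assign; case: eqP => // ne.
    by apply: Ha => //; rewrite inE negb_or nL andbT; apply/eqP=> -[].
  rewrite !Hass; case: ifP => // bx; case: ifP => // Ix.
  apply: IH => y Hy nL; apply: Ha => //; rewrite inE negb_or nL andbT.
  by apply/eqP => -[e]; move: Hy; rewrite e bx Ix.
- by rewrite (IH a a') // => x Hx nL; apply: Ha => //; rewrite inE negb_or nL.
Qed.

Lemma eq_sem (b b' I I' : pred nat) phi L a :
  {in ivars L, b =1 b'} -> {in ivars L, I =1 I'} ->
  sem b I phi L a = sem b' I' phi L a.
Proof.
elim: L a => [//|[x|] L IH] a /= eb eI; last by rewrite IH.
have [ebL eIL] : {in ivars L, b =1 b'} /\ {in ivars L, I =1 I'}.
  by split=> y yL; [apply: eb|apply: eI]; rewrite inE yL orbT.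
have -> : restrict b L = restrict b' L.
  by apply: eq_in_filter => i; case: i => // y yL; rewrite ebL // mem_ivars.
by rewrite eb ?eI ?inE ?eqxx // !IH.
Qed.

Definition without (z : nat) (L : items) : items := [seq i <- L | i != Some z].

Lemma without_id z L : Some z \notin L -> without z L = L.
Proof.
move=> zL; apply/all_filterP/allP => i iL.
by apply: contraNneq zL => <-.
Qed.

(** Images commute with unions. Where [z] is the root, both sides unite the same four branches, and
    [vunionACA] regroups them. *)
Lemma vforget_union z L u v : uniq (ivars L) -> has_shape L u -> has_shape L v ->
  vforget z L (vunion L u v) = vunion (without z L) (vforget z L u) (vforget z L v).
Proof.
have mapU (f : tree -> tree) s t :
    tcanon (map f (tuni s t)) = tuni (tcanon (map f s)) (tcanon (map f t)).
  apply: tset_eq; rewrite ?tuni_sorted ?tcanon_sorted // => e.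
  rewrite mem_tcanon mem_tuni mem_cat !mem_tcanon -mem_cat -map_cat.
  by apply: eq_mem_map => d; rewrite mem_tuni.
elim: L u v => [|[x|] L IH] u v /=.
- by move=> _ [s [-> ? _]] [t [-> ? _]]; rewrite !elems_tset mapU.
- case/andP=> xL uL [l [r [-> sl sr]]] [l' [r' [-> sl' sr']]].
  rewrite (_ : (Some x == Some z) = (z == x)); last exact: eq_sym.
  case: eqP => [->|_] /=; last by congr tnode; apply: IH.
  by rewrite /= without_id -?mem_ivars //; apply: vunionACA.
- by move=> _ [s [-> ? _]] [t [-> ? _]]; rewrite !elems_tset mapU.
Qed.

Lemma vforget_shape z L u : uniq (ivars L) -> has_shape L u ->
  has_shape (without z L) (vforget z L u).
Proof.
have mapE (f : tree -> tree) s (P : tree -> Prop) :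
    (forall e, e \in s -> P (f e)) ->
    forall e, e \in tcanon (map f s) -> P e.
  by move=> H e; rewrite mem_tcanon => /mapP[d ds ->]; apply: H.
elim: L u => [|[x|] L IH] u /=.
- move=> _ [s [-> ss us]]; eexists; split; [reflexivity|exact: tcanon_sorted|].
  by apply: mapE => e _; rewrite inE.
- case/andP=> xL uL [l [r [-> sl sr]]]; 
  rewrite (_ : (Some x == Some z) = (z == x)); last exact: eq_sym.
  case: eqP => [->|_] /=.
    rewrite without_id -?mem_ivars //; exact: vunion_shape.
  by eexists; eexists; split; [reflexivity|apply: IH|apply: IH].
- move=> uL [s [-> ss us]]; eexists; split; [reflexivity|exact: tcanon_sorted|].
  by apply: mapE => e; rewrite elems_tset => /us es; apply: IH.
Qed.

Lemma vforget_sem z (b I : pred nat) phi L a : uniq (ivars L) -> b z -> ~~ I z ->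
  Some z \in L ->
  vforget z (restrict b L) (sem b I phi L a) =
  sem (predD1 b z) (predU1 z I) phi L a.
Proof.
elim: L a => [//|[x|] L IH] a /= uL bz Iz zL; last first.
  by rewrite IH.
case/andP: uL => xL uL.
move: zL; rewrite inE (_ : (Some z == Some x) = (z == x)) // (eq_sym x z).
case: eqP => [ezx _|/eqP nzx /= zL].
  subst x; rewrite bz /= eqxx.
  have nz y : y \in ivars L -> (y == z) = false.
    by move=> yL; apply: contraNF xL => /eqP <-.
  have e c : sem b I phi L c = sem (predD1 b z) (predU1 z I) phi L c.
    by apply: eq_sem => y yL /=; rewrite nz.
  rewrite !e; congr vunion; apply: eq_in_filter => i; case: i => //= y.
  by rewrite -mem_ivars => yL; rewrite nz.
have nxz : (x == z) = false by rewrite eq_sym (negPf nzx).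
rewrite ?nxz /=; case: (b x); first by rewrite /= ?(negPf nzx) ?nxz !IH.
(* A variable above [z] that is already projected away has made the type a union, over which
   forgetting distributes. *)
case: (I x) => /=; last exact: IH.
rewrite vforget_union ?IH //; try exact: sem_shape; last first.
  by rewrite ivars_restrict filter_uniq.
congr vunion; rewrite /without -filter_predI; apply: eq_in_filter => -[y|] //= _.
Qed.

Lemma tests_node x y l r : tests x (tnode y l r) = (x == y).
Proof. by rewrite /tests /= (inj_eq tname_inj). Qed.

Lemma tests_tset x s : tests x (tset s) = false.
Proof. by rewrite /tests tname_fork. Qed.

Lemma tests_shape x L v : Some x \notin L -> has_shape L v -> tests x v = false.
Proof.
case: L => [|[y|] L]; rewrite ?inE ?negb_or /=.
- by move=> _ [s [-> _ _]]; apply: tests_tset.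
- case/andP=> nxy _ [l [r [-> _ _]]]; rewrite tests_node.
  by apply: contraNF nxy => /eqP ->.
- by move=> _ [s [-> _ _]]; apply: tests_tset.
Qed.

Lemma vjoin_shape (b b2 : pred nat) L u v :
  uniq (ivars L) -> (forall x, b2 x -> b x) ->
  has_shape (restrict b L) u -> has_shape (restrict b2 L) v ->
  has_shape (restrict b L) (vjoin (restrict b L) u v).
Proof.
move=> + bb; elim: L u v => [|[x|] L IH] u v /=.
- move=> _ [s [-> ss us]] [t [-> st ut]].
  eexists; split; [reflexivity|exact: tcanon_sorted|].
  by move=> e; rewrite mem_tcanon => /allpairsP[[? ?] [_ _ ->]]; rewrite inE.
- case/andP=> xL uL; case bx: (b x); last first.
    rewrite (_ : b2 x = false); first exact: IH.
    by apply: contraFF bx; apply: bb.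
  case=> [l [r [-> sl sr]]]; case b2x: (b2 x) => /=.
    case=> [l' [r' [-> sl' sr']]]; rewrite tests_node eqxx.
    by eexists; eexists; split; [reflexivity|apply: IH|apply: IH].
  move=> sv; rewrite (tests_shape _ sv).
    by eexists; eexists; split; [reflexivity|apply: IH|apply: IH].
  by rewrite -mem_ivars ivars_restrict mem_filter (negPf xL) andbF.
- move=> uL [s [-> ss us]] [t [-> st ut]].
  eexists; split; [reflexivity|exact: tcanon_sorted|].
  move=> e; rewrite mem_tcanon !elems_tset => /allpairsP[[c d] [/us cs /ut ds ->]].
  exact: IH.
Qed.

Lemma vjoin_unionl (b b2 : pred nat) L u u' v :
  uniq (ivars L) -> (forall x, b2 x -> b x) ->
  has_shape (restrict b L) u -> has_shape (restrict b L) u' ->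
    has_shape (restrict b2 L) v ->
  vjoin (restrict b L) (vunion (restrict b L) u u') v =
  vunion (restrict b L) (vjoin (restrict b L) u v) (vjoin (restrict b L) u' v).
Proof.
have pairU (f : tree -> tree -> tree) s s' t :
    tcanon [seq f c d | c <- tuni s s', d <- t] =
    tuni (tcanon [seq f c d | c <- s, d <- t])
         (tcanon [seq f c d | c <- s', d <- t]).
  apply: tset_eq; rewrite ?tuni_sorted ?tcanon_sorted // => e.
  rewrite mem_tuni mem_cat !mem_tcanon.
  apply/allpairsP/orP => [[[c d] [/= + dt ->]]|[]/allpairsP[[c d] [/= cs dt ->]]].
  - rewrite mem_tuni mem_cat => /orP[cs|cs]; [left|right];
      by apply/allpairsP; exists (c, d).
  - by exists (c, d); rewrite /= mem_tuni mem_cat cs.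
  - by exists (c, d); rewrite /= mem_tuni mem_cat cs orbT.
move=> + bb; elim: L u u' v => [|[x|] L IH] u u' v /=.
- by move=> _ [s [-> ? _]] [s' [-> ? _]] [t [-> ? _]]; rewrite !elems_tset pairU.
- case/andP=> xL uL; case bx: (b x); last first.
    rewrite (_ : b2 x = false); first exact: IH.
    by apply: contraFF bx; apply: bb.
  case=> [l [r [-> sl sr]]] [l2 [r2 [-> sl2 sr2]]]; case b2x: (b2 x) => /=.
    case=> [l' [r' [-> sl' sr']]]; rewrite tests_node eqxx.
    by congr tnode; apply: IH.
  move=> sv; rewrite (tests_shape _ sv) /=; first by congr tnode; apply: IH.
  by rewrite -mem_ivars ivars_restrict mem_filter (negPf xL) andbF.
- by move=> _ [s [-> ? _]] [s' [-> ? _]] [t [-> ? _]]; rewrite !elems_tset pairU.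
Qed.

Lemma vjoin_unionr (b b2 : pred nat) L u v v' :
  uniq (ivars L) -> (forall x, b2 x -> b x) ->
  has_shape (restrict b L) u -> has_shape (restrict b2 L) v ->
    has_shape (restrict b2 L) v' ->
  vjoin (restrict b L) u (vunion (restrict b2 L) v v') =
  vunion (restrict b L) (vjoin (restrict b L) u v) (vjoin (restrict b L) u v').
Proof.
have pairU (f : tree -> tree -> tree) s t t' :
    tcanon [seq f c d | c <- s, d <- tuni t t'] =
    tuni (tcanon [seq f c d | c <- s, d <- t])
         (tcanon [seq f c d | c <- s, d <- t']).
  apply: tset_eq; rewrite ?tuni_sorted ?tcanon_sorted // => e.
  rewrite mem_tuni mem_cat !mem_tcanon.
  apply/allpairsP/orP => [[[c d] [/= cs + ->]]|[]/allpairsP[[c d] [/= cs dt ->]]].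
  - rewrite mem_tuni mem_cat => /orP[dt|dt]; [left|right];
      by apply/allpairsP; exists (c, d).
  - by exists (c, d); rewrite /= mem_tuni mem_cat dt.
  - by exists (c, d); rewrite /= mem_tuni mem_cat dt orbT.
move=> + bb; elim: L u v v' => [|[x|] L IH] u v v' /=.
- by move=> _ [s [-> ? _]] [s' [-> ? _]] [t [-> ? _]]; rewrite !elems_tset pairU.
- case/andP=> xL uL; case bx: (b x); last first.
    rewrite (_ : b2 x = false); first exact: IH.
    by apply: contraFF bx; apply: bb.
  case=> [l [r [-> sl sr]]]; case b2x: (b2 x) => /=.
    case=> [l' [r' [-> sl' sr']]] [l2 [r2 [-> sl2 sr2]]].
    by rewrite !tests_node eqxx; congr tnode; apply: IH.
  have xR : Some x \notin restrict b2 L.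
    by rewrite -mem_ivars ivars_restrict mem_filter (negPf xL) andbF.
  move=> sv sv'; rewrite !(tests_shape xR) /=; try by [].
    by congr tnode; apply: IH.
  exact: vunion_shape.
- by move=> _ [s [-> ? _]] [s' [-> ? _]] [t [-> ? _]]; rewrite !elems_tset pairU.
Qed.

Definition depends_on (V : pred nat) (phi : (nat -> bool) -> bool) : Prop :=
  forall c c', (forall x, V x -> c x = c' x) -> phi c = phi c'.

(** A variable hidden on one side does not occur in the formula of the other side, whose type is
    therefore the same for both values; so the product distributes over the union that hides the
    variable. *)
Lemma vjoin_sem (b b2 I1 I2 : pred nat) phi1 phi2 L a :
  uniq (ivars L) -> (forall x, b2 x -> b x) ->
  (forall x, I1 x -> ~~ b x && ~~ I2 x) -> (forall x, I2 x -> ~~ b x) ->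
  depends_on (predU b I1) phi1 -> depends_on (predU b2 I2) phi2 ->
  vjoin (restrict b L) (sem b I1 phi1 L a) (sem b2 I2 phi2 L a) =
  sem b (predU I1 I2) (fun c => phi1 c && phi2 c) L a.
Proof.
move=> + bb H1 H2 D1 D2; elim: L a => [|[x|] L IH] a /=.
- by move=> _; case: (phi1 a) (phi2 a) => [] [].
- case/andP=> xL uL.
  have indep (b' I' : pred nat) phi c v : depends_on (predU b' I') phi ->
      ~~ b' x -> ~~ I' x -> sem b' I' phi L (assign c x v) = sem b' I' phi L c.
    move=> D nb nI; apply: sem_ext => // y Hy _; rewrite /assign.
    by case: eqP Hy => // ->; rewrite (negPf nb) (negPf nI).
  case bx: (b x) => /=.
    have nI2 : ~~ I2 x by apply: contraL bx; apply: H2.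
    case b2x: (b2 x) => /=; first by rewrite tests_node eqxx !IH.
    rewrite (negPf nI2) (tests_shape _ (sem_shape _ _ _ _ _)); last first.
      by rewrite -mem_ivars ivars_restrict mem_filter (negPf xL) andbF.
    by rewrite -!IH //; congr tnode; congr vjoin; apply/esym/indep => //; rewrite b2x.
  have b2x : b2 x = false by apply: contraFF bx; apply: bb.
  rewrite b2x; case I1x: (I1 x) => /=.
    have /andP[_ nI2] := H1 _ I1x; rewrite (negPf nI2).
    rewrite (vjoin_unionl uL bb) //; try exact: sem_shape.
    by rewrite -!IH //; congr vunion; congr vjoin; apply/esym/indep => //; rewrite b2x.
  case I2x: (I2 x); last exact: IH.
  rewrite (vjoin_unionr uL bb) //; try exact: sem_shape.
  rewrite -!IH //; congr vunion; congr vjoin; apply/esym/indep => //;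
    by rewrite ?bx ?I1x.
- by move=> uL; rewrite IH.
Qed.

(** * Evaluating closed types *)

Fixpoint veval (q : bool) (L : items) (u : tree) : bool :=
  match L with
  | [::] => elems u != [::]
  | Some _ :: _ => false
  | None :: L' => (if q then @has else @all) _ (veval (~~ q) L') (elems u)
  end.

(* [q] is true for an existential first block. The last block has to be
   existential, for the empty set stands for false. *)
Fixpoint qval (q : bool) (L : items) (phi : (nat -> bool) -> bool)
    (a : nat -> bool) : bool :=
  match L with
  | [::] => phi a
  | Some x :: L' =>
      let l := qval q L' phi (assign a x false) in
      let r := qval q L' phi (assign a x true) in
      if q then l || r else l && r
  | None :: L' => qval (~~ q) L' phi a
  end.

(** Says that the last block is existential when the first one has kind [q]. *)
Definition closed_last (q : bool) (L : items) : bool := q (+) odd (count_mem None L).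

(** Nonemptiness of a union is a disjunction, which suits the last block only if it is existential;
    this is what [closed_last] guarantees. *)
Lemma veval_union q L u v : all (pred1 None) L -> closed_last q L ->
  has_shape L u -> has_shape L v ->
  veval q L (vunion L u v) =
  if q then veval q L u || veval q L v else veval q L u && veval q L v.
Proof.
case: L => [|[x|] L] //= _.
- rewrite /closed_last addbF => -> [s [-> _ _]] [t [-> _ _]]; rewrite !elems_tset.
  have := mem_tuni s t; case: s t (tuni s t) => [|d s] [|e t] [|c r] //= H.
  + by have := H c; rewrite inE eqxx.
  + by have := H e; rewrite inE eqxx.
  + by have := H d; rewrite inE eqxx.
  + by have := H d; rewrite inE eqxx.
- move=> _ [s [-> _ _]] [t [-> _ _]]; rewrite !elems_tset.
  have Huni := mem_tuni s t; case: q.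
    by rewrite -has_cat; apply: eq_has_r.
  by rewrite -all_cat; apply: eq_all_r.
Qed.

Lemma veval_sem q (I : pred nat) phi L a : closed_last q L ->
  {in ivars L, forall x, I x} ->
  veval q (restrict pred0 L) (sem pred0 I phi L a) = qval q L phi a.
Proof.
elim: L q a => [|[x|] L IH] q a /=.
- by move=> _ _; case: (phi a).
- move=> cl HI; rewrite HI ?inE ?eqxx //.
  have HIL : {in ivars L, forall x, I x} by move=> y yL; rewrite HI // inE yL orbT.
  have e : count_mem None (restrict pred0 L) = count_mem None L.
    by elim: (L) => //= [[y|]] L' /= -> .
  rewrite veval_union ?IH //; try exact: sem_shape.
    by rewrite all_filter; apply/allP => -[].
  by rewrite /closed_last e.
- rewrite /closed_last /= addbN -addNb => cl HI.
  by case: q cl => cl; rewrite /= IH // ?orbF ?andbT.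
Qed.

(** * The program *)

Notation "# n" := (TVar n) (at level 1, format "# n").
Notation "f @( x , .. , y )" := (TCall f (TFork x .. (TFork y TLeaf) ..))
  (at level 5).

Notation fcmp := 0.
Notation fmem := 1.
Notation flookup := 2.
Notation fclause := 3.
Notation fmatrix := 4.
Notation fbase := 5.
Notation fins := 6.
Notation funi := 7.
Notation funion := 8.
Notation fforget := 9.
Notation fforgetset := 10.
Notation fjoin := 11.
Notation frow := 12.
Notation fprod := 13.
Notation fforgetbag := 14.
Notation ftype := 15.
Notation fhas := 16.
Notation fall := 17.
Notation fapp := 18.
Notation fitems := 19.
Notation flast := 20.

Definition TTrue : term := TFork TLeaf TLeaf.

(* The comments show the environment from index 0 on. *)
Definition prog : seq term := [::
  (* fcmp: x y *)
  TMatch #0 (TMatch #1 TLeaf TTrue)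
    (* a b x y *)
    (TMatch #3 (TFork TTrue TLeaf)
      (* c d a b x y *)
      (TMatch (fcmp @(#2, #0)) (fcmp @(#3, #1)) (TFork #0 #1)));
  (* fmem: x s *)
  TMatch #1 TLeaf
    (* y s' x s *)
    (TMatch (fcmp @(#2, #0)) TTrue (fmem @(#4, #3)));
  (* flookup: x env *)
  TMatch #1 TLeaf
    (* p env' x env *)
    (TMatch #0 TLeaf
      (* y b p env' x env *)
      (TMatch (fcmp @(#4, #0)) (TFork #1 TLeaf) (flookup @(#6, #5))));
  (* fclause: c env *)
  TMatch #0 TLeaf
    (* s c' c env *)
    (TMatch #1 TLeaf
      (* x c'' s c' c env *)
      (TMatch (flookup @(#0, #5)) TTrue
        (* b _ x c'' s c' c env *)
        (TMatch #0 (TMatch #4 TTrue (fclause @(#5, #9)))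
                   (TMatch #6 (fclause @(#5, #9)) TTrue))));
  (* fmatrix: m env *)
  TMatch #0 TTrue
    (* c m' m env *)
    (TMatch (fclause @(#0, #3)) TLeaf (fmatrix @(#3, #5)));
  (* fbase: items bag env m *)
  TMatch #0
    (TMatch (fmatrix @(#3, #2)) (TFork TLeaf TLeaf)
       (TFork TLeaf (TFork (TFork TLeaf TLeaf) TLeaf)))
    (* i items' items bag env m *)
    (TMatch #0 (TFork TLeaf (TFork (fbase @(#1, #3, #4, #5)) TLeaf))
      (* _ _ i items' items bag env m *)
      (TMatch (fmem @(#2, #5)) (fbase @(#3, #5, #6, #7))
        (* _ _ _ _ i items' items bag env m *)
        (TFork #4 (TFork
          (fbase @(#5, #7, TFork (TFork #4 TLeaf) #8, #9))
          (fbase @(#5, #7, TFork (TFork #4 TTrue) #8, #9))))));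
  (* fins: x s *)
  TMatch #1 (TFork #0 TLeaf)
    (* y s' x s *)
    (TMatch (fcmp @(#2, #0)) #3
      (* c _ y s' x s *)
      (TMatch #0 (TFork #4 #5) (TFork #4 (fins @(#6, #5)))));
  (* funi: s t *)
  TMatch #0 #1
    (* e s' s t *)
    (fins @(#0, funi @(#1, #3)));
  (* funion: u v *)
  TMatch #0 TLeaf
    (* x p u v *)
    (TMatch #3 TLeaf
      (* y q x p u v *)
      (TMatch #2 (TFork TLeaf (funi @(#3, #1)))
        (* _ _ y q x p u v *)
        (TMatch #5 TLeaf
          (* l r _ _ y q x p u v *)
          (TMatch #5 TLeaf
            (* l' r' l r _ _ y q x p u v *)
            (TFork #8 (TFork (funion @(#2, #0)) (funion @(#3, #1))))))));
  (* fforget: z u *)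
  TMatch #1 TLeaf
    (* x p z u *)
    (TMatch #0 (TFork TLeaf (fforgetset @(#2, #1)))
      (* _ _ x p z u *)
      (TMatch #3 TLeaf
        (* l r _ _ x p z u *)
        (TMatch (fcmp @(#6, #4)) (funion @(#0, #1))
          (* _ _ l r _ _ x p z u *)
          (TFork #6 (TFork (fforget @(#8, #2)) (fforget @(#8, #3)))))));
  (* fforgetset: z s *)
  TMatch #1 TLeaf
    (* e s' z s *)
    (fins @(fforget @(#2, #0), fforgetset @(#2, #1)));
  (* fjoin: u v *)
  TMatch #0 TLeaf
    (* x p u v *)
    (TMatch #0
      (TMatch #3 TLeaf
        (* y q x p u v *)
        (TFork TLeaf (fprod @(#3, #1))))
      (* _ _ x p u v *)
      (TMatch #3 TLeaf
        (* l r _ _ x p u v *)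
        (TMatch #7 TLeaf
          (* y q l r _ _ x p u v *)
          (TMatch (fcmp @(#6, #0))
            (TMatch #1 TLeaf
              (* l' r' y q l r _ _ x p u v *)
              (TFork #8 (TFork (fjoin @(#4, #0)) (fjoin @(#5, #1)))))
            (* _ _ y q l r _ _ x p u v *)
            (TFork #8 (TFork (fjoin @(#4, #11)) (fjoin @(#5, #11))))))));
  (* frow: d t acc *)
  TMatch #1 #2
    (* e t' d t acc *)
    (fins @(fjoin @(#2, #0), frow @(#2, #1, #4)));
  (* fprod: s t *)
  TMatch #0 TLeaf
    (* d s' s t *)
    (frow @(#0, #3, fprod @(#1, #3)));
  (* fforgetbag: c b u *)
  TMatch #0 #2
    (* x c' c b u *)
    (TMatch (fmem @(#0, #3)) (fforgetbag @(#1, #3, fforget @(#0, #4)))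
      (fforgetbag @(#3, #5, #6)));
  (* ftype: bag children items m *)
  TMatch #1 (fbase @(#2, #0, TLeaf, #3))
    (* c rest bag children items m *)
    (TMatch #1 TLeaf
      (* cc children' c rest bag children items m *)
      (fjoin @(ftype @(#4, #1, #6, #7),
               fforgetbag @(#2, #4, ftype @(#2, #0, #6, #7)))));
  (* fhas: s *)
  TMatch #0 TLeaf
    (* e s' s *)
    (TMatch #0 TLeaf
      (* _ t e s' s *)
      (TMatch (fall @(#1)) (fhas @(#3)) TTrue));
  (* fall: s *)
  TMatch #0 TTrue
    (* e s' s *)
    (TMatch #0 TLeaf
      (* _ t e s' s *)
      (TMatch (fhas @(#1)) TLeaf (fall @(#5))));
  (* fapp: s t *)
  TMatch #0 #1
    (* x s' s t *)
    (TFork #0 (fapp @(#1, #3)));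
  (* fitems: blocks *)
  TMatch #0 TLeaf
    (* q rest blocks *)
    (TMatch #1 TLeaf
      (* s blocks' q rest blocks *)
      (TMatch #1 (fapp @(#0, TLeaf))
        (* q' _ s blocks' q rest blocks *)
        (fapp @(#2,
          TMatch #0
            (TMatch #4 (fitems @(#3)) (TFork TLeaf (fitems @(#5))))
            (* _ _ q' _ s blocks' q rest blocks *)
            (TMatch #6 (TFork TLeaf (fitems @(#5))) (fitems @(#7)))))));
  (* flast: blocks q *)
  TMatch #0 #1
    (* q' rest blocks q *)
    (TMatch #1 TLeaf
      (* s blocks' q' rest blocks q *)
      (flast @(#1, #2)))].

(* blocks matrix bag children *)
Definition main : term :=
  TMatch (fforgetbag @(#2, TLeaf, ftype @(#2, #3, fitems @(#0), #1))) TLeaf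
    (* _ s blocks matrix bag children *)
    (TMatch (flast @(#2, TLeaf))
      (TMatch (TMatch #2 TLeaf #0)
        (TMatch (fhas @(#1)) TTrue TLeaf)
        (TMatch (fall @(#3)) TTrue TLeaf))
      (* _ _ _ s blocks matrix bag children *)
      (TMatch (TMatch #4 TLeaf #0) (fall @(#3)) (fhas @(#5)))).

Lemma prog_calls_ok : all (calls_ok (size prog)) prog && calls_ok (size prog) main.
Proof. by []. Qed.

Notation runs := (computes prog).

Ltac enter := apply: wp_runs => /=.
Ltac open_name x :=
  let E := fresh "E" in
  case E: (tname x) => [|? ?];
  [by move: E; rewrite tname_fork | rewrite /= -E {E}].
Ltac call H := eexists; eexists; split; [apply: H | ].

(** * Correctness and cost of the program *)

(** Twice the number of forks, because [fcmp] makes at most two calls per fork of its first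
    argument. *)
Fixpoint tsize (t : tree) : nat :=
  if t is Fork a b then tsize a + tsize b + 2 else 0.

Lemma runs_cmp x y : runs fcmp (tlist [:: x; y]) (tcmp x y) (tsize x).
Proof.
elim: x y => [|a IHa b IHb] [|c d]; enter; try by split.
call IHa => /=; case e: (tcmp a c) => [|h t]; last by split=> //; lia.
by call IHb; split=> //; lia.
Qed.

Lemma runs_mem x s W : tsize (tname x) <= W ->
  runs fmem (tlist [:: tname x; tnames s]) (tbool (x \in s)) (size s * (W + 2)).
Proof.
move=> xW; elim: s => [|y s IH]; enter; first by split.
call runs_cmp => /=; rewrite inE -(inj_eq tname_inj).
case e: (tcmp _ _) => [|h t] /=.
  by move/tcmp_eq: e xW => -> ?; rewrite eqxx; split=> //; lia.
have -> : tname x == tname y = false by apply/eqP => /tcmp_eq; rewrite e.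
by call IH; split=> //; lia.
Qed.

Definition tenv (env : seq (nat * bool)) : tree :=
  tlist [seq Fork (tname p.1) (tbool p.2) | p <- env].

Fixpoint lookup (env : seq (nat * bool)) (x : nat) : option bool :=
  if env is p :: env' then if x == p.1 then Some p.2 else lookup env' x
  else None.

Lemma runs_lookup x env W : tsize (tname x) <= W ->
  runs flookup (tlist [:: tname x; tenv env])
    (if lookup env x is Some b then Fork (tbool b) Leaf else Leaf)
    (size env * (W + 2)).
Proof.
move=> xW; elim: env => [|[y b] env IH]; enter; first by split.
call runs_cmp => /=; rewrite -(inj_eq tname_inj).
case e: (tcmp _ _) => [|h t] /=.
  by move/tcmp_eq: e xW => -> ?; rewrite eqxx; split=> //; lia.
have -> : tname x == tname y = false by apply/eqP => /tcmp_eq; rewrite e.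
by call IH; split=> //; lia.
Qed.

(* The variables of the current bag are assigned; a literal on another variable
   passes, hence a clause is only checked at the bags that contain it. *)
Definition passes (env : seq (nat * bool)) (l : literal) : bool :=
  if lookup env l.2 is Some b then b == l.1 else true.

Lemma runs_clause c env W : all (fun l => tsize (tname l.2) <= W) c ->
  runs fclause (tlist [:: tclause c; tenv env]) (tbool (has (passes env) c))
    (size c * (size env * (W + 2) + 2)).
Proof.
elim: c => [|[s x] c IH] /= => [_|/andP[xW /IH{}IH]]; enter; first by split.
call (runs_lookup env xW); rewrite /passes /=.
case: (lookup env x) => [b|] /=; last by split=> //; lia.
case: b s => [] [] /=; try by split=> //; lia.
  by call IH; split=> //; lia.
by call IH; split=> //; lia.
Qed.

Definition clause_ok (W M : nat) (c : seq literal) : bool :=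
  (size c <= M) && all (fun l => tsize (tname l.2) <= W) c.

Lemma runs_matrix m env W M : all (clause_ok W M) m ->
  runs fmatrix (tlist [:: tmatrix m; tenv env])
    (tbool (all (has (passes env)) m))
    (size m * (M * (size env * (W + 2) + 2) + 2)).
Proof.
elim: m => [|c m IH] /= => [_|/andP[/andP[cM cW] /IH{}IH]]; enter; first by split.
call (runs_clause env cW) => /=.
have : size c * (size env * (W + 2) + 2) <= M * (size env * (W + 2) + 2).
  by rewrite leq_mul2r cM orbT.
set k := M * _ in IH *; move: (size c * _) => k1 le; rewrite mulSn.
case: has => /=; last by split=> //; lia.
by move: (size m * _) IH => k2 IH; call IH; split=> //; lia.
Qed.

Definition titems (L : items) : tree :=
  tlist [seq if i is Some x then tname x else Leaf | i <- L].

Definition check (m : seq (seq literal)) (b : pred nat) (a : nat -> bool) : bool :=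
  all (has (fun l : literal => ~~ b l.2 || (a l.2 == l.1))) m.

(** This lemma and the next solve the recurrences of [runs_base]: [E] is the number of leaves of the
    decision tree, [q] the work per item, and [s] grows with the number of items. *)
Lemma single_step c d E s q :
  c + q <= E * (s * q) -> 0 < E -> d <= q -> c + d + q <= E * (s.+1 * q).
Proof.
move=> L E0 dq; have ->
  : E * (s.+1 * q) = E * (s * q) + E * q by rewrite mulSn mulnDr addnC.
by have := leq_pmull q E0; lia.
Qed.

Lemma double_step c0 c1 d E s q :
  c0 + q <= E * (s * q) -> c1 + q <= E * (s * q) -> 0 < E -> d <= q ->
  c0 + c1 + d + q <= 2 * E * (s.+1 * q).
Proof.
move=> L0 L1 E0 dq; have := single_step L0 E0 dq; have := single_step L1 E0 dq.
by rewrite -mulnA mul2n -addnn; lia.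
Qed.

(** [env] holds the bag variables already passed. A variable outside the bag is skipped, since the
    check at this bag does not read it. *)
Lemma runs_base m b L env W M N q a :
  all (clause_ok W M) m -> {in ivars L, forall x, tsize (tname x) <= W} ->
  uniq (ivars L) -> size env + size L <= N ->
  size m * (M * (N * (W + 2) + 2) + 2) + size b * (W + 2) + 3 <= q ->
  (forall x, lookup env x =
     if (x \in b) && (Some x \notin L) then Some (a x) else None) ->
  exists2 c,
    runs fbase (tlist [:: titems L; tnames b; tenv env; tmatrix m])
      (sem (mem b) pred0 (check m (mem b)) L a) c
    & c + q <= 2 ^ size (ivars (restrict (mem b) L)) * ((size L).+2 * q).
Proof.
move=> okm + + + leq_q; elim: L env a => [|[x|] L IH] env a LW uL szN Henv.
- exists q; last by rewrite expn0 mul1n mul2n -addnn.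
  have le : size env * (W + 2) <= N * (W + 2) by rewrite leq_mul2r orbC -(addn0 (size env)) szN.
  have le2 : size m * (M * (size env * (W + 2) + 2) + 2) <=
      size m * (M * (N * (W + 2) + 2) + 2).
    by apply: leq_mul => //; rewrite leq_add2r leq_mul // leq_add2r.
  enter; call (runs_matrix env okm) => /=.
  have -> : check m (mem b) a = all (has (passes env)) m.
    apply: eq_all => c; apply: eq_has => l; rewrite /passes Henv andbT.
    by rewrite /=; case: (l.2 \in b).
  by case: all => /=; split=> //; move: leq_q; lia.
- have /andP[xL uL'] : (x \notin ivars L) && uniq (ivars L) by [].
  have LW' : {in ivars L, forall x, tsize (tname x) <= W}.
    by move=> y yL; apply: LW; rewrite inE yL orbT.
  have xW : tsize (tname x) <= W by apply: LW; rewrite inE eqxx.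
  rewrite /=; case xb: (x \in b) => /=.
    have Hstep v : exists2 c,
        runs fbase (tlist [:: titems L; tnames b; tenv ((x, v) :: env); tmatrix m])
          (sem (mem b) pred0 (check m (mem b)) L (assign a x v)) c
        & c + q <= 2 ^ size (ivars (restrict (mem b) L)) * ((size L).+2 * q).
      apply: IH => //; first by rewrite /= addSnnS.
      move=> y /=; rewrite /assign; case: (eqVneq y x) => [->|ne] /=.
        by rewrite xb -mem_ivars xL.
      by rewrite Henv inE negb_or (_ : (Some y == Some x) = (y == x)) // (negPf ne).
    have [c0 R0 L0] := Hstep false; have [c1 R1 L1] := Hstep true.
    exists (c0 + c1 + (size b * (W + 2) + 3)).
      enter; open_name x; call (runs_mem b xW); rewrite xb /=.
      by call R0; call R1; split=> //; lia.
    rewrite expnS; apply: double_step L0 L1 _ _; rewrite ?expn_gt0 //.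
    by move: leq_q; lia.
  have szN' : size env + size L <= N by move: szN => /=; lia.
  have Henv' y : lookup env y =
      if (y \in b) && (Some y \notin L) then Some (a y) else None.
    rewrite Henv inE negb_or (_ : (Some y == Some x) = (y == x)) //.
    by case: eqP => [->|//]; rewrite xb.
  have [c R Lc] := IH env a LW' uL' szN' Henv'.
  exists (c + (size b * (W + 2) + 2)).
    by enter; open_name x; call (runs_mem b xW); rewrite xb /=; call R; split=> //; lia.
  apply: single_step Lc _ _; rewrite ?expn_gt0 //.
  by move: leq_q; lia.
- have szN' : size env + size L <= N by move: szN => /=; lia.
  have Henv' y : lookup env y =
      if (y \in b) && (Some y \notin L) then Some (a y) else None.
    by rewrite Henv inE.
  have [c R Lc] := IH env a LW uL szN' Henv'.
  exists (c + 1); first by enter; call R; split=> //; lia.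
  by apply: single_step Lc _ _; rewrite ?expn_gt0 //; move: leq_q; lia.
Qed.

(** * The number and the size of types *)

Fixpoint ntypes (L : items) : nat :=
  match L with
  | [::] => 2
  | Some _ :: L' => ntypes L' ^ 2
  | None :: L' => 2 ^ ntypes L'
  end.

Fixpoint subseqs (s : seq tree) : seq (seq tree) :=
  if s is x :: s' then map (cons x) (subseqs s') ++ subseqs s' else [:: [::]].

Fixpoint types (L : items) : seq tree :=
  match L with
  | [::] => [:: tset [::]; tset [:: tunit]]
  | Some x :: L' => [seq tnode x l r | l <- types L', r <- types L']
  | None :: L' => [seq tset (tcanon s) | s <- subseqs (types L')]
  end.

Lemma size_types L : size (types L) = ntypes L.
Proof.
elim: L => [|[x|] L IH] //=; first by rewrite size_allpairs IH mulnn.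
rewrite size_map -IH; elim: (types L) => //= x s IHs.
by rewrite size_cat size_map IHs addnn -mul2n expnS.
Qed.

Lemma filter_subseqs (p : pred tree) s : filter p s \in subseqs s.
Proof.
elim: s => //= x s IH; rewrite mem_cat; case: (p x); last by rewrite IH orbT.
by rewrite map_f.
Qed.

Lemma shape_types L u : has_shape L u -> u \in types L.
Proof.
elim: L u => [|[x|] L IH] u /=.
- case=> [[|d [|e s]] [-> ss us]]; rewrite !inE ?eqxx //.
    by have := us d; rewrite !inE eqxx => /(_ isT) /eqP ->; rewrite eqxx orbT.
  have := us e; have := us d; rewrite !inE !eqxx ?orbT => /(_ isT) /eqP ed.
  move=> /(_ isT) /eqP ee; move: ss => /= /andP[].
  by rewrite ed ee tlt_irr.
- by case=> [l [r [-> /IH ll /IH rr]]]; apply: allpairs_f.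
(* The sublist of [types L] with the elements of [s] has [s] as its canonical list. *)
- case=> s [-> ss us]; apply/mapP; exists (filter (mem s) (types L)).
    exact: filter_subseqs.
  congr tset; apply: tset_eq => //; first exact: tcanon_sorted.
  move=> e; rewrite mem_tcanon mem_filter /=; case es: (e \in s) => //=.
  by rewrite IH //; apply: us.
Qed.

Lemma ntypes_gt1 L : 1 < ntypes L.
Proof.
elim: L => [//|[x|] L IH] /=; first by rewrite -{1}(exp1n 2) ltn_exp2r.
by apply: leq_trans (ltn_expl _ (isT : 1 < 2)); rewrite ltnW.
Qed.

Lemma ntypes_restrict (b b2 : pred nat) L : (forall x, b2 x -> b x) ->
  ntypes (restrict b2 L) <= ntypes (restrict b L).
Proof.
move=> bb; elim: L => [//|[x|] L IH] /=; last by rewrite leq_pexp2l.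
case b2x: (b2 x); first by rewrite (bb _ b2x) /= leq_exp2r.
case: (b x) => //=; apply: leq_trans IH _.
by rewrite -mulnn leq_pmulr // ltnW // ntypes_gt1.
Qed.

(* [cbound W L] bounds the size of a type and the cost of every operation on
   types for the prefix L, with some slack that depends on the bound W on the
   size of names. *)
Fixpoint cbound (W : nat) (L : items) : nat :=
  match L with
  | [::] => W + 100
  | Some _ :: L' => 2 * cbound W L'
  | None :: L' => 8 * ntypes L' ^ 3 * cbound W L'
  end.

Definition names_ok (W : nat) (L : items) : Prop :=
  forall x, Some x \in L -> tsize (tname x) <= W.

Lemma names_ok_cons W i L : names_ok W (i :: L) -> names_ok W L.
Proof. by move=> H x xL; apply: H; rewrite inE xL orbT. Qed.

Lemma names_ok_restrict W b L : names_ok W L -> names_ok W (restrict b L).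
Proof. by move=> H x; rewrite mem_filter => /andP[_ /H]. Qed.

(** Origin of the cube: a product of two sets forms up to [m * m] pairs, and each result, computed
    at cost [A], is inserted into a list of up to [m] types. The slack [W + 5] pays for comparing a
    name and for a few surrounding calls. *)
Lemma cbound_None W L A : W + 5 <= cbound W L ->
  A <= cbound W L -> 
  let m := ntypes L in
  m * (m * (A + m * cbound W L) + 2) + 1 + (W + 5) <= cbound W (None :: L).
Proof.
move=> /= WG AG; have := ntypes_gt1 L.
move: (ntypes L) (cbound W L) WG AG => m G WG AG m1.
have -> : 8 * m ^ 3 * G = 8 * (m * (m * (m * G))) by rewrite !expnS expn0; lia.
have [m2 mG] : m <= m * m /\ 2 * G <= m * G by nia.
have : m * A <= m * G by nia.
have h1 : m * G <= m * (m * G) by apply: leq_pmull; lia.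
have h2 : m * (m * G) <= m * (m * (m * G)) by apply: leq_pmull; lia.
have h3 : m * (m * A) <= m * (m * G) by rewrite !leq_mul.
have h4 : m * 2 <= m * G by rewrite leq_mul //; lia.
have -> : m * (m * (A + m * G) + 2) = m * (m * A) + m * (m * (m * G)) + m * 2.
  by rewrite !mulnDr.
lia.
Qed.

Lemma cbound_ge W L : W + 5 <= cbound W L.
Proof.
elim: L => [|[x|] L IH] /=; [lia|lia|].
have := cbound_None IH (leq0n _); rewrite /=; lia.
Qed.

(** Treats both kinds of set elements at once: units after the last block, types of the remaining
    blocks elsewhere. *)
Definition bounded (P : tree -> Prop) (m S : nat) : Prop :=
  (forall e, P e -> tsize e <= S) /\
  (forall s, sorted tlt s -> (forall e, e \in s -> P e) -> size s <= m).

Lemma tsize_tlist s S : (forall e, e \in s -> tsize e <= S) ->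
  tsize (tlist s) <= size s * (S + 2).
Proof.
elim: s => //= x s IH H; have := H x (mem_head _ _).
have := IH (fun e es => H e (@mem_behead _ (x :: s) e es)); lia.
Qed.

Lemma shape_size L s : sorted tlt s -> (forall e, e \in s -> has_shape L e) ->
  size s <= ntypes L.
Proof.
move=> ss Hs; rewrite -size_types; apply: uniq_leq_size; first exact: tset_uniq.
by move=> e /Hs/shape_types.
Qed.

Lemma shape_tsize W L u : names_ok W L -> has_shape L u ->
  tsize u + (W + 5) <= cbound W L.
Proof.
elim: L u => [|[x|] L IH] u okL /=.
- case=> s [-> ss us]; have : size s <= 1 by apply: (uniq_leq_size (tset_uniq ss) us).
  have : tsize (tlist s) <= size s * (2 + 2).
    by apply: tsize_tlist => e /us; rewrite inE => /eqP ->.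
  rewrite /=; lia.
- case=> [l [r [-> /IH Hl /IH Hr]]] /=.
  have := Hl (names_ok_cons okL); have := Hr (names_ok_cons okL).
  have := okL x; rewrite inE eqxx => /(_ isT); lia.
- case=> s [-> ss us]; have m1 := shape_size ss us.
  have GW := cbound_ge W L.
  have : tsize (tlist s) <= size s * (cbound W L - 2 + 2).
    by apply: tsize_tlist => e /us /(IH _ (names_ok_cons okL)); lia.
  have -> : cbound W L - 2 + 2 = cbound W L by lia.
  have := cbound_None GW (leq0n _); rewrite /= add0n.
  have := ntypes_gt1 L; move: m1.
  move: (ntypes L) (cbound W L) GW (size s) (tsize _) => m G GW k t km m2.
  have : k * G <= m * G by rewrite leq_mul.
  have : m * G <= m * (m * (m * G)) by rewrite leq_mul // mulnA leq_pmull // muln_gt0; lia.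
  rewrite mulnDr; lia.
Qed.

Lemma shape_bounded W L : names_ok W L ->
  bounded (has_shape L) (ntypes L) (cbound W L - (W + 5)).
Proof.
move=> okL; split=> [e /(shape_tsize okL)|]; first by lia.
exact: shape_size.
Qed.

Lemma unit_bounded : bounded (eq tunit) 1 2.
Proof.
split=> [e <- //|s ss Hs]; apply: (@uniq_leq_size _ _ [:: tunit]).
  exact: tset_uniq.
by move=> e /Hs <-; rewrite inE.
Qed.

(** * Cost of the operations on sets and on types *)

Lemma runs_ins (x : tree) (s : seq tree) : runs fins (tlist [:: x;
  tlist s]) (tlist (tins x s))
  (size s * (tsize x + 2)).
Proof.
elim: s => [|y s IH]; enter; first by split.
call runs_cmp => /=; case: (tcmp_cases x y) => e; rewrite e /=.
- by split=> //; lia.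
- by split=> //; lia.
- by call IH; split=> //; lia.
Qed.

Section Bounded.
Variables (P : tree -> Prop) (m S : nat).
Hypothesis PmS : bounded P m S.

Lemma runs_ins_bounded (x : tree) (s : seq tree) : P x -> sorted tlt s ->
  (forall e, e \in s -> P e) ->
  runs fins (tlist [:: x; tlist s]) (tlist (tins x s)) (m * (S + 2)).
Proof.
case: PmS => HS Hm Px ss Hs; apply: runs_leq (runs_ins x s) _.
by apply: leq_mul; [apply: Hm | rewrite leq_add2r HS].
Qed.

Lemma runs_uni (s t : seq tree) :
  sorted tlt t -> (forall e, e \in s -> P e) -> (forall e, e \in t -> P e) ->
  runs funi (tlist [:: tlist s; tlist t]) (tlist (tuni s t))
    (size s * (m * (S + 2) + 2)).
Proof.
move=> st Hs Ht; elim: s Hs => [|x s IH] Hs; enter; first by split.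
have Hs' e : e \in s -> P e by move=> es; apply: Hs; rewrite inE es orbT.
call (IH Hs'); call runs_ins_bounded; [..|by split=> //; lia].
- by apply: Hs; rewrite inE eqxx.
- exact: tuni_sorted.
- by move=> e; rewrite mem_tuni mem_cat => /orP[/Hs'|/Ht].
Qed.

Lemma runs_forgetset z (f : tree -> tree) (s : seq tree) c :
  (forall e, e \in s -> runs fforget (tlist [:: tname z; e]) (f e) c) ->
  (forall e, e \in s -> P (f e)) ->
  runs fforgetset (tlist [:: tname z; tlist s]) (tlist (tcanon (map f s)))
    (size s * (c + m * (S + 2) + 3)).
Proof.
elim: s => [|x s IH] Hf HP; enter; first by split.
have xs : x \in x :: s by rewrite inE eqxx.
have sub e : e \in s -> e \in x :: s by rewrite inE orbC => ->.
call (Hf x xs); call (IH (fun e es => Hf e (sub e es)) (fun e es => HP e (sub e es))).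
call runs_ins_bounded; [..|by split=> //; lia].
- exact: HP.
- exact: tcanon_sorted.
- by move=> e; rewrite mem_tcanon => /mapP[d /sub ds ->]; apply: HP.
Qed.

Lemma runs_row (d : tree) (f : tree -> tree) (t acc : seq tree) c :
  (forall e, e \in t -> runs fjoin (tlist [:: d; e]) (f e) c) ->
  (forall e, e \in t -> P (f e)) ->
  sorted tlt acc -> (forall e, e \in acc -> P e) ->
  runs frow (tlist [:: d; tlist t; tlist acc]) (tlist (tuni (map f t) acc))
    (size t * (c + m * (S + 2) + 3)).
Proof.
move=> + + sacc Hacc; elim: t => [|x s IH] Hf HP; enter; first by split.
have xs : x \in x :: s by rewrite inE eqxx.
have sub e : e \in s -> e \in x :: s by rewrite inE orbC => ->.
call (Hf x xs); call (IH (fun e es => Hf e (sub e es)) (fun e es => HP e (sub e es))).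
call runs_ins_bounded; [..|by split=> //; lia].
- exact: HP.
- exact: tuni_sorted.
- move=> e; rewrite mem_tuni mem_cat => /orP[/mapP[y /sub ys ->]|];
  [exact: HP|exact: Hacc].
Qed.

Lemma runs_prod (f : tree -> tree -> tree) (s t : seq tree) c :
  (forall d e, d \in s -> e \in t -> runs fjoin (tlist [:: d; e]) (f d e) c) ->
  (forall d e, d \in s -> e \in t -> P (f d e)) ->
  runs fprod (tlist [:: tlist s; tlist t])
    (tlist (tcanon [seq f d e | d <- s, e <- t]))
    (size s * (size t * (c + m * (S + 2) + 3) + 2)).
Proof.
elim: s => [|x s IH] Hf HP; enter; first by split.
have xs : x \in x :: s by rewrite inE eqxx.
have sub e : e \in s -> e \in x :: s by rewrite inE orbC => ->.
call (IH (fun d e ds => Hf d e (sub d ds)) (fun d e ds => HP d e (sub d ds))).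
call (@runs_row x (f x)).
- by move=> e; apply: Hf.
- by move=> e; apply: HP.
- exact: tcanon_sorted.
- by move=> e; rewrite mem_tcanon => /allpairsP[[? ?] [/sub ? ? ->]]; apply: HP.
- by rewrite /tcanon /tuni foldr_cat; split=> //; lia.
Qed.
End Bounded.

Lemma cbound_restrict W (b b2 : pred nat) L : (forall x, b2 x -> b x) ->
  cbound W (restrict b2 L) <= cbound W (restrict b L).
Proof.
move=> bb; elim: L => [//|[x|] L IH] /=.
  case b2x: (b2 x); first by rewrite (bb _ b2x) leq_mul.
  case: (b x) => //=; apply: leq_trans IH _; exact: leq_pmull.
apply: leq_mul => //; apply: leq_mul => //.
by rewrite leq_exp2r // ntypes_restrict.
Qed.

Lemma bounded_weaken P m S m' S' :
  bounded P m S -> m <= m' -> S <= S' -> bounded P m' S'.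
Proof.
move=> [HS Hm] mm SS; split=> [e /HS h|s ss /(Hm _ ss) h]; exact: leq_trans h _.
Qed.

(** One estimate for all set operations: a product has [k] rows and [l] columns, a projection has
    [l = 1], and a union has [A = 0]. *)
Lemma set_cost W L k l A S :
  k <= ntypes L -> l <= ntypes L -> A <= cbound W L -> S + 2 <= cbound W L ->
  k * (l * (A + ntypes L * (S + 2)) + 2) + 1 <= cbound W (None :: L) - (W + 5).
Proof.
move=> km lm AG SG; have := cbound_None (cbound_ge W L) AG.
move: (cbound W (None :: L)) => C /= le.
suff : k * (l * (A + ntypes L * (S + 2)) + 2) <=
    ntypes L * (ntypes L * (A + ntypes L * cbound W L) + 2).
  by move: (k * _) (ntypes L * _) le; lia.
by rewrite leq_mul // leq_add2r leq_mul // leq_add2l leq_mul.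
Qed.

Lemma runs_union W L u v : names_ok W L -> has_shape L u -> has_shape L v ->
  runs funion (tlist [:: u; v]) (vunion L u v) (cbound W L - (W + 5)).
Proof.
elim: L u v => [|[x|] L IH] u v okL /=.
- case=> s [-> ss us] [t [-> st ut]]; rewrite !elems_tset; enter.
  have us' e : e \in s -> tunit = e by move=> /us; rewrite inE => /eqP.
  have ut' e : e \in t -> tunit = e by move=> /ut; rewrite inE => /eqP.
  call (runs_uni unit_bounded st us' ut'); split=> //.
  have : size s <= 1 by apply: (unit_bounded.2).
  lia.
- case=> l [r [-> sl sr]] [l' [r' [-> sl' sr']]]; enter; open_name x.
  have okL' := names_ok_cons okL; have := cbound_ge W L.
  call (IH _ _ okL' sl sl'); call (IH _ _ okL' sr sr'); split=> //; lia.
- case=> s [-> ss us] [t [-> st ut]]; rewrite !elems_tset; enter.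
  have okL' := names_ok_cons okL; have := cbound_ge W L.
  have B := shape_bounded okL'.
  call (runs_uni B st us ut); split=> //.
  have m1 := shape_size ss us.
  have := @set_cost W L (size s) (ntypes L) 0 (cbound W L - (W + 5)) m1 (leqnn _) (leq0n _).
  move=> /(_ ltac:(lia)); set G := cbound W (None :: L) - _; rewrite -/G.
  have := ntypes_gt1 L; move: (ntypes L) (size s) (_ - _ + 2) G => m k S G m2.
  have : k * (m * S + 2) <= k * (m * (0 + m * S) + 2).
    by rewrite leq_mul // leq_add2r leq_mul // add0n leq_pmull //; lia.
  lia.
Qed.

Lemma without_restrict z L : without z L = restrict (predC1 z) L.
Proof. by apply: eq_filter => -[]. Qed.

Lemma restrict_true L : restrict predT L = L.
Proof. by apply/all_filterP/allP => -[]. Qed.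

Lemma runs_forget W z L u : uniq (ivars L) -> names_ok W L ->
  tsize (tname z) <= W -> has_shape L u ->
  runs fforget (tlist [:: tname z; u]) (vforget z L u) (cbound W L - (W + 5)).
Proof.
move=> + + zW; elim: L u => [|[x|] L IH] u uL okL /=.
- case=> s [-> ss us]; rewrite elems_tset; enter.
  call (@runs_forgetset _ _ _ unit_bounded z (fun=> tunit) s 1).
  + move=> e /us; rewrite inE => /eqP ->; enter.
    by exists Leaf, 0; split; first by enter; split.
  + by [].
  + split=> //; have : size s <= 1 by apply: (uniq_leq_size (tset_uniq ss) us).
    lia.
- case=> l [r [-> sl sr]]; enter; open_name x.
  have okL' := names_ok_cons okL; have GW := cbound_ge W L.
  have /andP[_ uL'] : (x \notin ivars L) && uniq (ivars L) by [].
  call runs_cmp => /=; rewrite -(inj_eq tname_inj).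
  case e: (tcmp _ _) => [|h t] /=.
    move/tcmp_eq: e => ->; rewrite eqxx.
    call (runs_union okL' sl sr); split=> //.
    have := okL x; rewrite inE eqxx => /(_ isT); lia.
  have -> : tname z == tname x = false by apply/eqP => /tcmp_eq; rewrite e.
  call (IH _ uL' okL' sl); call (IH _ uL' okL' sr); split=> //; lia.
- case=> s [-> ss us]; rewrite !elems_tset; enter.
  have okL' := names_ok_cons okL; have GW := cbound_ge W L.
  have B : bounded (has_shape (without z L)) (ntypes L) (cbound W L - (W + 5)).
    rewrite without_restrict.
    refine (bounded_weaken (shape_bounded (@names_ok_restrict W (predC1 z) L okL')) _ _).
      by rewrite -{2}(restrict_true L) ntypes_restrict.
    by rewrite leq_sub2r // -{2}(restrict_true L) cbound_restrict.
  call (@runs_forgetset _ _ _ B z (vforget z L) s (cbound W L - (W + 5))).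
  + by move=> e /us es; apply: IH.
  + by move=> e /us es; apply: vforget_shape.
  + split=> //; have m1 := shape_size ss us.
    have := @set_cost W L (size s) 1 (cbound W L) (cbound W L - (W + 5)) m1 _ (leqnn _).
    move=> /(_ (ltnW (ntypes_gt1 L)) ltac:(lia)).
    set G := cbound W (None :: L) - _; rewrite -/G mul1n.
    move: (ntypes L * _) => k.
    have : size s * (cbound W L - (W + 5) + k + 3) <= size s * (cbound W L + k + 2).
      by rewrite leq_mul //; lia.
    lia.
Qed.

Lemma runs_join W (b b2 : pred nat) L u v : uniq (ivars L) -> names_ok W L ->
  (forall x, b2 x -> b x) -> has_shape (restrict b L) u -> has_shape (restrict b2 L) v ->
  runs fjoin (tlist [:: u; v]) (vjoin (restrict b L) u v)
    (cbound W (restrict b L) - (W + 5)).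
Proof.
move=> + + bb; elim: L u v => [|[x|] L IH] u v uL okL /=.
- case=> s [-> ss us] [t [-> st ut]]; rewrite !elems_tset; enter.
  call (@runs_prod _ _ _ unit_bounded (fun _ _ => tunit) s t 1).
  + move=> d e /us + /ut; rewrite !inE => /eqP -> /eqP ->; enter.
    by exists Leaf, 0; split; first by enter; split.
  + by [].
  + split=> //; have : size s <= 1 by apply: (uniq_leq_size (tset_uniq ss) us).
    have : size t <= 1 by apply: (uniq_leq_size (tset_uniq st) ut).
    move: (size s) (size t) => [|[|?]] [|[|?]] //=; lia.
- have okL' := names_ok_cons okL.
  have /andP[xL uL'] : (x \notin ivars L) && uniq (ivars L) by [].
  case bx: (b x); last first.
    rewrite (_ : b2 x = false); first exact: IH.
    by apply: contraFF bx; apply: bb.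
  have GW := cbound_ge W (restrict b L).
  have xW : tsize (tname x) <= W by apply: okL; rewrite inE eqxx.
  case=> l [r [-> sl sr]]; case b2x: (b2 x) => /=.
    case=> l' [r' [-> sl' sr']]; rewrite tests_node eqxx; enter; open_name x.
    call runs_cmp; have /tcmp_eq -> /= : tname x = tname x by [].
    call (IH _ _ uL' okL' sl sl'); call (IH _ _ uL' okL' sr sr'); split=> //; lia.
  move=> sv; have tv : tests x v = false.
    apply: tests_shape sv.
    by rewrite -mem_ivars ivars_restrict mem_filter (negPf xL) andbF.
  rewrite tv; enter; open_name x.
  (* [fjoin] compares [x] with the head of [v], which exists because every type is a fork, even an
     empty set. *)
  have [y [q ev]] : exists y q, v = Fork y q.
    case: (restrict b2 L) sv => [|[y|] L'] /=.
    - by case=> s [-> _ _]; eexists; eexists.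
    - by case=> ? [? [-> _ _]]; eexists; eexists.
    - by case=> s [-> _ _]; eexists; eexists.
  rewrite {1}ev; call runs_cmp => /=.
  case e: (tcmp _ _) => [|h t] /=.
    by move/tcmp_eq: e tv => e; rewrite /tests ev /= -e eqxx.
  call (IH _ _ uL' okL' sl sv); call (IH _ _ uL' okL' sr sv); split=> //; lia.
- case=> s [-> ss us] [t [-> st ut]]; rewrite !elems_tset; enter.
  have okL' := names_ok_cons okL; have GW := cbound_ge W (restrict b L).
  have B := shape_bounded (@names_ok_restrict W b L okL').
  call (@runs_prod _ _ _ B (vjoin (restrict b L)) s t
          (cbound W (restrict b L) - (W + 5))).
  + by move=> d e /us ds /ut et; apply: IH.
  + by move=> d e /us ds /ut et; apply: vjoin_shape et.
  + split=> //; have m1 := shape_size ss us.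
    have m2 := leq_trans (shape_size st ut) (ntypes_restrict L bb).
    move: (restrict b L) GW m1 m2 => L' GW m1 m2.
    have := @set_cost W L' _ _ (cbound W L' - 2) (cbound W L' - (W + 5)) m1 m2.
    move=> /(_ (leq_subr _ _) ltac:(lia)).
    set G := cbound W (None :: L') - _; rewrite -/G.
    set A := (X in X -> _); set C := (X in _ -> X).
    suff : size s * (size t * (cbound W L' - (W + 5) + ntypes L' *
        (cbound W L' - (W + 5) + 2) + 3) + 2) <=
      size s * (size t * (cbound W L' - 2 + ntypes L' *
        (cbound W L' - (W + 5) + 2)) + 2) by rewrite /A /C; lia.
    by rewrite leq_mul // leq_add2r leq_mul //; lia.
Qed.

(** * Tree decompositions *)

Fixpoint bags (T : tdec) : seq (seq nat) :=
  let: TNode b ts := T in b :: flatten (map bags ts).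

Definition tvars (T : tdec) : seq nat := flatten (bags T).

Lemma mem_tvars x T : reflect (exists2 b, b \in bags T & x \in b) (x \in tvars T).
Proof. exact: flattenP. Qed.

Lemma bags_cons b t ts B :
  (B \in bags (TNode b (t :: ts))) = (B \in bags t) || (B \in bags (TNode b ts)).
Proof. by rewrite /= !inE mem_cat; case: (B \in bags t); rewrite ?orbT. Qed.

Lemma tvars_cons b t ts x :
  (x \in tvars (TNode b (t :: ts))) = (x \in tvars t) || (x \in tvars (TNode b ts)).
Proof.
by rewrite /tvars /= !mem_cat flatten_cat mem_cat orbCA.
Qed.

Lemma bag_bags T : bag T \in bags T.
Proof. by case: T => b ts; rewrite inE eqxx. Qed.

Lemma bag_tvars T x : x \in bag T -> x \in tvars T.
Proof. by move=> xT; apply/mem_tvars; exists (bag T) => //; apply: bag_bags. Qed.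

Lemma bag_at_bags T a x : x \in bag_at T a -> bag_at T a \in bags T.
Proof.
elim: a T => [|i a IH] [b ts] /=; first by rewrite inE eqxx.
have [its|its] := ltnP i (size ts); last first.
  rewrite nth_default //.
  suff -> : bag_at (TNode [::] [::]) a = [::] by [].
  by elim: (a) => //= j a' IHa; rewrite nth_nil.
move=> /IH H; rewrite inE; apply/orP; right; apply/flattenP.
exists (bags (nth (TNode [::] [::]) ts i)) => //.
by rewrite -(nth_map _ [::]) // mem_nth // size_map.
Qed.

(** Renames the address of a node when a new first child is put under the root. *)
Definition shift (a : seq nat) : seq nat := if a is i :: a' then i.+1 :: a' else [::].

Lemma bag_at_shift b t ts a :
  bag_at (TNode b (t :: ts)) (shift a) = bag_at (TNode b ts) a.
Proof. by case: a. Qed.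

Lemma bags_bag_at T B : B \in bags T -> exists a, bag_at T a = B.
Proof.
elim/tdec_ind2: T => [b|b t ts IH1 IH2].
  by rewrite inE => /eqP ->; exists [::].
rewrite bags_cons => /orP[/IH1 [a <-]|/IH2 [a <-]]; first by exists (0 :: a).
by exists (shift a); rewrite bag_at_shift.
Qed.

Lemma tvars_bag_at T x : x \in tvars T -> exists a, x \in bag_at T a.
Proof. by case/mem_tvars => B /bags_bag_at[a <-]; exists a. Qed.

(* A vertex that occurs both inside and outside of a subtree occurs at both
   ends of the edge above it. *)
Definition crossing (T : tdec) : Prop :=
  forall u i v w x, x \in bag_at T (u ++ i :: v) -> x \in bag_at T w ->
  ~~ prefix (rcons u i) w -> (x \in bag_at T (rcons u i)) && (x \in bag_at T u).

(** The addresses with prefix [rcons u i] form a subtree, and the edge from [rcons u i] to [u] is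
    the only way out of it. *)
Lemma path_cross u i a p :
  path tree_adj a p -> prefix (rcons u i) a -> ~~ prefix (rcons u i) (last a p) ->
  (rcons u i \in a :: p) && (u \in p).
Proof.
elim: p a => [|c p IH] a /=; first by move=> _ ->.
case/andP=> adj pp pa np; case pc: (prefix (rcons u i) c).
  by have /andP[h1 h2] := IH c pp pc np; rewrite inE h1 orbT inE h2 orbT.
case/orP: adj => /andP[ne /eqP e].
  move: pc; rewrite -(cat_take_drop (size c).-1 c) -e.
  by case/prefixP: pa => z ->; rewrite -catA prefix_prefix.
case/prefixP: pa e => z; elim/last_ind: z => [|z j _] ->.
  rewrite cats0 size_rcons /= -cats1 take_size_cat // => ->.
  by rewrite !inE !eqxx.
rewrite -rcons_cat size_rcons /= -(cats1 (rcons u i ++ z) j) take_size_cat // => ec.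
by move: pc; rewrite ec prefix_prefix.
Qed.

Lemma decomposition_crossing psi T : tree_decomposition psi T -> crossing T.
Proof.
case=> _ _ _ _ conn u i v w x xa xw npw.
have [p [pp lp /allP ap]] := conn x _ _ xa xw.
have pa : prefix (rcons u i) (u ++ i :: v) by rewrite -cat_rcons prefix_prefix.
rewrite -lp in npw; have /andP[h1 h2] := path_cross pp pa npw.
rewrite (ap u h2) andbT.
by move: h1; rewrite inE => /orP[/eqP ->|/ap].
Qed.

(** Connectedness of the occurrences in a form that can be used by induction when children are
    peeled off. *)
Inductive separated : tdec -> Prop :=
  | separated0 b : separated (TNode b [::])
  | separatedS b t ts :
      separated t -> separated (TNode b ts) ->
      (forall x, x \in tvars t -> x \in tvars (TNode b ts) ->
         (x \in bag t) && (x \in b)) ->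
      separated (TNode b (t :: ts)).

Lemma crossing_separated T : crossing T -> separated T.
Proof.
elim/tdec_ind2: T => [b|b t ts IH1 IH2] H; first exact: separated0.
apply: separatedS.
- apply: IH1 => u i v w x xa xw np.
  exact: (H (0 :: u) i v (0 :: w) x xa xw).
- apply: IH2 => u i v w x; rewrite -!(bag_at_shift b t ts).
  case: u => [|j u] /=.
    move=> xa xw np; apply: (H [::] i.+1 v (shift w) x xa xw).
    by case: w np {xw} => //= k w; rewrite !eqSS.
  move=> xa xw np; apply: (H (j.+1 :: u) i v (shift w) x xa xw).
  by case: w np {xw} => //= k w; rewrite !eqSS.
- move=> x /tvars_bag_at[v xv] /tvars_bag_at[w]; rewrite -(bag_at_shift b t ts) => xw.
  have := H [::] 0 v (shift w) x xv xw; rewrite /=; case: (t) => bt tts /=.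
  by apply; case: w xw.
Qed.

(** If all of [s] occurs outside of the child [t], a pair that meets in [t] also lies in [b].
    Otherwise some [z] of [s] occurs only in [t], its pairs bring all of [s] into [t], and a pair
    that meets outside also lies in [bag t]. *)
Lemma separated_helly T (s : seq nat) : separated T ->
  {in s &, forall x y, exists2 B, B \in bags T & (x \in B) && (y \in B)} ->
  exists2 B, B \in bags T & {subset s <= B}.
Proof.
move=> sepT; elim: sepT s => [b|b t ts _ IH1 _ IH2 sep] s Hs.
  exists b; first by rewrite inE.
  by move=> x xs; have [B] := Hs x x xs xs; rewrite inE => /eqP -> /andP[].
have inV T' B (x : nat) : B \in bags T' -> x \in B -> x \in tvars T'.
  by move=> BT xB; apply/mem_tvars; exists B.
case: (boolP (all (fun x => x \in tvars (TNode b ts)) s)) => [/allP sV|/allPn[z zs zV]].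
  have [x y xs ys|B BT sB] := IH2 s; last by exists B; rewrite // bags_cons BT orbT.
  have [B] := Hs x y xs ys; rewrite bags_cons => /orP[Bt|BT] /andP[xB yB].
    have /andP[_ xb] := sep x (inV _ _ _ Bt xB) (sV x xs).
    have /andP[_ yb] := sep y (inV _ _ _ Bt yB) (sV y ys).
    by exists b; rewrite ?inE ?eqxx ?xb.
  by exists B; rewrite ?xB.
have sV x : x \in s -> x \in tvars t.
  move=> xs; have [B] := Hs z x zs xs; rewrite bags_cons => /orP[Bt|BT] /andP[zB xB].
    exact: inV xB.
  by case/negP: zV; apply: inV zB.
have [x y xs ys|B BT sB] := IH1 s; last by exists B; rewrite // bags_cons BT.
have [B] := Hs x y xs ys; rewrite bags_cons => /orP[Bt|BT] /andP[xB yB].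
  by exists B; rewrite ?xB.
have /andP[xb _] := sep x (sV x xs) (inV _ _ _ BT xB).
have /andP[yb _] := sep y (sV y ys) (inV _ _ _ BT yB).
by exists (bag t); rewrite ?bag_bags ?xb.
Qed.

Lemma clause_in_bag psi T c : qbf_wf psi -> tree_decomposition psi T ->
  c \in qmatrix psi -> exists2 B, B \in bags T & {subset clause_vars c <= B}.
Proof.
case/andP=> _ /allP wf td cm.
apply: separated_helly; first exact/crossing_separated/decomposition_crossing/td.
move=> x y xc yc; have := wf c cm => /allP sub.
have [<-|nxy] := eqVneq x y.
  have [a xa] := td_vertex td (sub x xc).
  by exists (bag_at T a); rewrite ?(bag_at_bags xa) ?xa.
have [|a /andP[xa ya]] := td_edge td (x := x) (y := y).
  by rewrite /primal_edge nxy; apply/hasP; exists c; rewrite ?xc.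
by exists (bag_at T a); rewrite ?(bag_at_bags xa) ?xa.
Qed.

Definition tcheck (m : seq (seq literal)) (T : tdec) (a : nat -> bool) : bool :=
  all (fun B => check m (mem B) a) (bags T).

(** Some bag contains the clause and checks it in full; the checks at the other bags are weaker. *)
Lemma tcheck_cnf psi T a : qbf_wf psi -> tree_decomposition psi T ->
  tcheck (qmatrix psi) T a = all (has (lit_true a)) (qmatrix psi).
Proof.
move=> wf td; apply/allP/allP => H.
  move=> c cm; have [B BT cB] := clause_in_bag wf td cm.
  have /allP/(_ c cm)/hasP[l lc] := H B BT.
  rewrite /= cB ?map_f //= => lt; by apply/hasP; exists l.
move=> B _; apply/allP => c /H /hasP[l lc lt]; apply/hasP; exists l => //.
by apply/orP; right.
Qed.

Lemma check_depends m (B : seq nat) : depends_on (mem B) (check m (mem B)).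
Proof.
move=> c c' H; apply: eq_all => cl; apply: eq_has => l /=.
by case lB: (l.2 \in B) => //=; rewrite H.
Qed.

Lemma tcheck_depends m (T : tdec) : depends_on (mem (tvars T)) (tcheck m T).
Proof.
move=> c c' H; apply: eq_in_all => B BT; apply: check_depends => x xB.
by apply: H; apply/mem_tvars; exists B.
Qed.

(** * The type of a tree decomposition *)

Definition inner (T : tdec) : pred nat := fun x => (x \in tvars T) && (x \notin bag T).

Definition tsem (m : seq (seq literal)) (L : items) (T : tdec) : tree :=
  sem (mem (bag T)) (inner T) (tcheck m T) L (fun=> false).

Lemma runs_forgetbag W (c b : seq nat) (B I : pred nat) phi L a G :
  uniq (ivars L) -> names_ok W L -> uniq c ->
    {in c, forall x, [/\ B x, ~~ I x & x \in ivars L]} ->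
  cbound W (restrict B L) <= G ->
  runs fforgetbag (tlist [:: tnames c; tnames b; sem B I phi L a])
    (sem (fun x => B x && ~~ ((x \in c) && (x \notin b)))
         (fun x => I x || ((x \in c) && (x \notin b))) phi L a)
    (size c * (size b * (W + 2) + G + 3)).
Proof.
move=> uL okL; elim: c B I => [|z c IH] B I /= uc Hc GB.
  enter; split=> //; apply: eq_sem => x _ /=; by rewrite ?andbT ?orbF.
case/andP: uc => zc uc; have [Bz Iz zL] := Hc z (mem_head _ _).
have zW : tsize (tname z) <= W by apply: okL; rewrite -mem_ivars.
have Hc' : {in c, forall x, [/\ B x, ~~ I x & x \in ivars L]}.
  by move=> x xc; apply: Hc; rewrite inE xc orbT.
enter; call (runs_mem b zW); case zb: (z \in b) => /=.
  call (IH B I uc Hc' GB); split; last by lia.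
  apply: eq_sem => x _ /=; rewrite inE; case: eqP => [->|//]; by rewrite zb !andbF.
have GW := cbound_ge W (restrict B L).
have uR : uniq (ivars (restrict B L)) by rewrite ivars_restrict filter_uniq.
call (runs_forget uR (@names_ok_restrict W B L okL) zW (sem_shape B I phi L a)).
rewrite vforget_sem //; last by rewrite -mem_ivars.
call (IH (predD1 B z) (predU1 z I)) => //.
- move=> x xc; have [Bx Ix xL] := Hc' x xc; rewrite /= Bx negb_or Ix.
  by have -> : x != z by apply: contraNneq zc => <-.
- apply: leq_trans GB; apply: cbound_restrict => x /andP[] //.
- split; last by lia.
  apply: eq_sem => x _ /=; rewrite inE; case: eqP => [->|_] //=.
  by rewrite zb /= andbF.
  by rewrite zb /= orbT.
Qed.

Fixpoint nnodes (T : tdec) : nat :=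
  let: TNode _ ts := T in (sumn (map nnodes ts)).+1.

(** Each node is charged [2 * Q], of which one [Q] stays in reserve for the whole tree. Peeling off
    a child splits the nodes between two trees without adding one, so the projection and the join
    are paid from the reserve that becomes free. *)
Lemma runs_type W M E Bn q G m L T :
  all (clause_ok W M) m -> uniq (ivars L) -> names_ok W L ->
  separated T ->
  (forall B, B \in bags T -> [/\ uniq B, {subset B <= ivars L}, size B <= Bn,
     2 ^ size (ivars (restrict (mem B) L)) <= E &
     cbound W (restrict (mem B) L) <= G]) ->
  size m * (M * (size L * (W + 2) + 2) + 2) + Bn * (W + 2) + 3 <= q ->
  exists2 c,
    runs ftype (tlist [:: tnames (bag T); tchildren T; titems L; tmatrix m])
      (tsem m L T) c &
    let Q := E * ((size L).+2 * q) + Bn * (Bn * (W + 2) + G + 3) + G + 4 in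
    c + Q <= 2 * Q * nnodes T.
Proof.
move=> okm uL okL sepT + leq_q; set Q := _ + 4.
have okL' : {in ivars L, forall x, tsize (tname x) <= W}.
  by move=> x; rewrite mem_ivars; apply: okL.
elim: sepT => [b|b t ts sept IH1 sepT IH2 sep] HB.
  have [ub bL bn bE bG] := HB b (mem_head _ _).
  have [|||c R Lc] :=
    @runs_base m b L [::] W M (size L) q (fun=> false) okm okL' uL _ _ _ => //.
  - by apply: leq_trans leq_q; rewrite leq_add2r leq_add2l leq_mul.
  - by move=> x; case: ifP => // /andP[/bL]; rewrite mem_ivars => ->.
  exists c.+1.
    enter; call R; split; last by lia.
    rewrite /tsem;
      transitivity (sem (mem b) pred0 (tcheck m (TNode b [::])) L (fun=> false)).
      by apply: sem_ext => // x y H; rewrite /tcheck /= andbT;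
        apply: check_depends => z zb; apply: H; apply/orP; left.
    by apply: eq_sem => // x _; rewrite /inner /tvars /= cats0 andbN.
  rewrite /= muln1.
  have : 2 ^ size (ivars (restrict (mem b) L)) * ((size L).+2 * q) <= E * ((size L).+2 * q).
    by rewrite leq_mul2r bE orbT.
  by move: Lc; rewrite /Q; lia.
have [|c1 R1 L1] := IH1; first by move=> B BT; apply: HB; rewrite bags_cons BT.
have [|c2 R2 L2] := IH2; first by move=> B BT; apply: HB; rewrite bags_cons BT orbT.
have [ub bL bn bE bG] := HB b (mem_head _ _).
have [|ut tL tn tE tG] := HB (bag t); first by rewrite bags_cons bag_bags.
(* The free and the hidden variables of the child after it has forgotten what leaves its bag. *)
pose B2 : pred nat := fun x => mem (bag t) x && ~~ ((x \in bag t) && (x \notin b)).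
pose I2 : pred nat := fun x => inner t x || ((x \in bag t) && (x \notin b)).
have B2b x : B2 x -> mem b x.
  by rewrite /B2 /=; case: (x \in bag t); case: (x \in b).
exists (c1 + c2 + (size (bag t) * (size b * (W + 2) + G + 3)) + (cbound W (restrict (mem b) L) - (W + 5)) + 4).
  enter; call R2; call R1.
  call (@runs_forgetbag W (bag t) b (mem (bag t)) (inner t) (tcheck m t) L
    (fun=> false) G) => //.
  - by move=> x xt; split; rewrite /inner /= ?xt ?andbF //; apply: tL.
  call (@runs_join W (mem b) B2 L) => //.
  - exact: sem_shape.
  - exact: sem_shape.
  split; last by rewrite /=; lia.
  rewrite /tsem -/B2 -/I2 vjoin_sem //.
  - transitivity (sem (mem b) (inner (TNode b (t :: ts)))
      (fun c => tcheck m (TNode b ts) c && tcheck m t c) L (fun=> false)).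
      apply: eq_sem => // x _; rewrite /= /inner tvars_cons /= /I2 /inner.
      have := sep x; have := @bag_tvars t x.
      have := @bag_tvars (TNode b ts) x; rewrite /=.
      case: (x \in b); case: (x \in bag t); case: (x \in tvars t);
        case: (x \in tvars _) => //= H1 H2 H3; by [have := H1 isT|have :=
          H2 isT|have := H3 isT isT].
    apply: sem_ext => // c c' H.
    have -> : tcheck m (TNode b (t :: ts)) c' = tcheck m (TNode b ts) c' && tcheck m t c'.
      by rewrite /tcheck /= all_cat; case: check => //=; rewrite andbC.
    have HV x : x \in tvars (TNode b (t :: ts)) -> c x = c' x.
      by move=> xV; apply: H; rewrite /inner xV /= orbN.
    congr (_ && _); apply: tcheck_depends => x /= xV; apply: HV;
      by rewrite tvars_cons xV ?orbT.
  (* By separation a variable shared with [t] lies in [b], so what is hidden in the rest is not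
     hidden in [t]. *)
  - move=> x /andP[xV xb]; rewrite xb /I2 /inner /=; apply/negP.
    have := sep x; have := @bag_tvars t x; rewrite /= in xb; rewrite xV (negPf xb) andbF.
    by case: (x \in tvars t); case: (x \in bag t) => //= H1 H2; [have :=
      H2 isT isT|have := H2 isT isT|have := H1 isT].
  - move=> x; rewrite /I2 /inner /=; have := sep x; have :=
    @bag_tvars (TNode b ts) x => /=.
    case: (x \in b) => //= H1 H2; rewrite (H1 isT) in H2.
    rewrite andbF orbF => /andP[/H2 /(_ isT)]; by case: (x \in bag t).
  - move=> c c' H; apply: tcheck_depends => x /= xV; apply: H.
    by rewrite /= /inner /= xV /= orbN.
  - move=> c c' H; apply: tcheck_depends => x /= xV; apply: H.
    rewrite /B2 /I2 /inner /= xV; by case: (x \in bag t); case: (x \in b).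
have le1 : size (bag t) * (size b * (W + 2) + G + 3) <= Bn * (Bn * (W + 2) + G + 3).
  by rewrite leq_mul // !leq_add2r leq_mul2r bn orbT.
have L1' : c1 + Q <= 2 * Q * nnodes t := L1.
have L2' : c2 + Q <= 2 * Q * nnodes (TNode b ts) := L2.
set ex := size (bag t) * _ in le1 *.
suff : c1 + c2 + ex + (cbound W (restrict (mem b) L) - (W + 5)) + 4 + Q <=
    2 * Q * (nnodes t + nnodes (TNode b ts)).
  by move=> le; rewrite /= -addnS.
rewrite mulnDr; move: (2 * Q * _) (2 * Q * _) L1' L2' => n1 n2 L1' L2'.
have : ex + (cbound W (restrict (mem b) L) - (W + 5)) + 4 <= Q.
  by move: le1; rewrite /Q; move: (_ * (_ + 3)) (_ * (_ * q)) => k1 k2; lia.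
lia.
Qed.

(** * The main program *)

(** The program treats the last block like the others: [fhas] meets a unit, which is an empty set,
    and [fall] accepts it, so that nonempty means true. *)
Lemma runs_veval q L s : all (pred1 None) L -> closed_last q L -> has_shape L (tset s) ->
  runs (if q then fhas else fall) (tlist [:: tlist s]) (tbool (veval q L (tset s)))
    (tsize (tlist s)).
Proof.
have inj r : tset s = tset r -> s = r by move=> [] /tlist_inj.
elim: L q s inj => [|i L IH] q s inj /=.
  rewrite /closed_last addbF elems_tset => _ -> [r [/inj <- _ us]].
  case: s us {inj} => [|e s] us; enter; first by split.
  have := us e (mem_head _ _); rewrite inE => /eqP -> /=.
  exists (tbool true), 0; split; first by enter; split.
  by split=> //=; lia.
case/andP=> /eqP -> Ln cl [r [/inj <- _ {inj}]].
rewrite elems_tset; elim: s => [|e s IHs] us.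
  by case: q cl => _; enter; split.
have {}IHs := IHs (fun d ds => us d (@mem_behead _ (e :: s) d ds)).
have se := us e (mem_head _ _).
have [w ew] : exists w, e = tset w.
  case: L Ln se {IH us cl IHs} => [|[x|] L] //= _; by case=> w [-> _ _]; exists w.
have cl' : closed_last (~~ q) L by move: cl; rewrite /closed_last /= addbN addNb.
have injr (r' : seq tree) : tset w = tset r' -> w = r' by move=> [] /tlist_inj.
rewrite ew in se *; have R := IH (~~ q) w injr Ln cl' se.
case: q {cl cl'} R IHs => R IHs; enter; call R => /=; case: veval => /=.
- by split=> //; lia.
- by call IHs; split=> //; lia.
- by call IHs; split=> //; lia.
- by split=> //; lia.
Qed.

Lemma runs_app (s : seq nat) t :
  runs fapp (tlist [:: tnames s; t]) (foldr Fork t (map tname s)) (size s).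
Proof.
elim: s => [|x s IH]; enter; first by split.
by call IH; split=> //; lia.
Qed.

Fixpoint block_items (bl : seq (quantifier * seq nat)) : items :=
  if bl is (q, s) :: bl' then
    map Some s ++
    (if bl' is (q', _) :: _ then
       if q == q' then block_items bl' else None :: block_items bl'
     else [::])
  else [::].

Lemma runs_items bl :
  runs fitems (tlist [:: tblocks bl]) (titems (block_items bl))
    (sumn [seq (size Qi.2).+2 | Qi <- bl]).
Proof.
have cat s L : foldr Fork (titems L) (map tname s) = titems (map Some s ++ L).
  by rewrite /titems map_cat /tlist foldr_cat -map_comp.
elim: bl => [|[q s] bl IH]; enter; first by split.
case: bl IH => [|[q' s'] bl] IH /=.
  by call (runs_app s Leaf); rewrite (cat s [::]); split=> //=; lia.
case: q; case: q' IH => IH /=.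
- call IH; call runs_app; rewrite cat; split=> //=; lia.
- call IH; call runs_app; rewrite (cat s (None :: _)); split=> //=; lia.
- call IH; call runs_app; rewrite (cat s (None :: _)); split=> //=; lia.
- call IH; call runs_app; rewrite cat; split=> //=; lia.
Qed.

Lemma runs_last bl q :
  runs flast (tlist [:: tblocks bl; tbool (is_exists q)])
    (tbool (is_exists (last q (unzip1 bl)))) (size bl).
Proof.
elim: bl q => [|[q' s] bl IH] q; enter; first by split.
by call IH; split=> //; lia.
Qed.

Definition outermost (psi : qbf) : quantifier := head Forall (unzip1 (qblocks psi)).
Definition qitems (psi : qbf) : items := block_items (qblocks psi).
Definition cnf (psi : qbf) (a : nat -> bool) : bool :=
  all (has (lit_true a)) (qmatrix psi).

Lemma ivars_cat L L' : ivars (L ++ L') = ivars L ++ ivars L'.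
Proof. exact: pmap_cat. Qed.

Lemma ivars_some s : ivars (map Some s) = s.
Proof. by elim: s => //= x s ->. Qed.

Lemma ivars_qitems psi : ivars (qitems psi) = qvars psi.
Proof.
rewrite /qvars /qprefix /qitems /unzip2; elim: (qblocks psi) => //= -[q s] bl IH.
rewrite map_cat ivars_cat ivars_some -map_comp map_id -IH; congr cat.
by case: bl {IH} => //= -[q' s'] bl; case: ifP.
Qed.

Lemma nruns_gt0 q s : 0 < nruns (q :: s).
Proof. by elim: s q => //= q' s IH q; apply: leq_trans (leq_addl _ _). Qed.

Lemma count_qitems psi : count_mem None (qitems psi) = qa psi.
Proof.
rewrite /qitems /qa; elim: (qblocks psi) => //= -[q s] bl IH.
rewrite count_cat (_ : count_mem None (map Some s) = 0) ?add0n; last by elim: s.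
case: bl IH => [|[q' s'] bl] //= IH.
have := nruns_gt0 q' (unzip1 bl); rewrite /=.
rewrite (_ : (Some q' == Some q) = (q == q')); last exact: eq_sym.
by case: (q == q') => /=; rewrite IH; lia.
Qed.

Lemma outermost_innermost psi :
  is_exists (outermost psi) = is_exists (innermost psi) (+) odd (qa psi).
Proof.
rewrite -count_qitems /qitems /outermost /innermost.
elim: (qblocks psi) => //= -[q s] bl IH.
rewrite count_cat (_ : count_mem None (map Some s) = 0) ?add0n; last by elim: s.
case: bl IH => [|[q' s'] bl] /=; first by rewrite addbF.
move: (is_exists (last _ _)) => e.
case: (eqVneq q q') => [->//|nq] /=.
move: (count _ _) => k IH; have ->
  : is_exists q = ~~ is_exists q' by case: q q' nq {IH} => [] [].
by rewrite IH /= addbN.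
Qed.

Lemma qval_ext q L phi psi a a' (V : pred nat) :
  (forall c c', (forall x, V x -> c x = c' x) -> phi c = psi c') ->
  (forall x, V x -> Some x \notin L -> a x = a' x) ->
  qval q L phi a = qval q L psi a'.
Proof.
move=> Hphi; elim: L q a a' => [|[x|] L IH] q a a' Ha /=.
- by apply: Hphi => x Vx; apply: Ha.
- have E v : qval q L phi (assign a x v) = qval q L psi (assign a' x v).
    apply: IH => y Vy yL; rewrite /assign; case: eqP => // ne.
    by apply: Ha => //; rewrite inE negb_or yL andbT; apply/eqP => -[].
  by rewrite !E.
- by apply: IH => x Vx xL; apply: Ha => //; rewrite inE negb_or.
Qed.

Lemma qval_neg q L phi a :
  qval (~~ q) L (fun c => ~~ phi c) a = ~~ qval q L phi a.
Proof.
elim: L q a => //= [[x|]] L IH q a; last exact: IH.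
by rewrite !IH; case: q; rewrite ?negb_or ?negb_and.
Qed.

Definition flip (a : nat -> bool) : nat -> bool := fun x => ~~ a x.

(* Negating a DNF negates its literals; this lemma restores them, so that the
   program can read the same matrix as a CNF. *)
Lemma qval_flip q L phi a : depends_on predT phi ->
  qval q L (fun c => phi (flip c)) a = qval q L phi (flip a).
Proof.
move=> D; elim: L q a => //= [[x|]] L IH q a; last exact: IH.
have E v : qval q L phi (flip (assign a x v)) = qval q L phi (assign (flip a) x (~~ v)).
  apply: (@qval_ext _ _ _ _ _ _ predT) => [|y _ _]; first exact: D.
  by rewrite /flip /assign; case: eqP.
by rewrite !IH !E /= orbC andbC.
Qed.

Lemma qval_prefix psi phi a :
  qval (is_exists (outermost psi)) (qitems psi) phi a = qeval (qprefix psi) phi a.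
Proof.
rewrite /outermost /qitems /qprefix; elim: (qblocks psi) a => //= -[q s] bl IH a.
elim: s a => /= [|x s IHs] a; last by rewrite !IHs; case: (q) IHs.
rewrite -IH; case: bl {IH} => //= -[q' s'] bl.
by case: eqP => [->|] //; case: q; case: q'.
Qed.

Lemma cnf_depends psi : qbf_wf psi -> depends_on (mem (qvars psi)) (cnf psi).
Proof.
case/andP => _ /allP wf c c' H; apply: eq_in_all => cl /wf /allP cq.
by apply: eq_in_has => l lc; rewrite /lit_true H //; apply: cq; apply: map_f.
Qed.

(** A DNF is handled through its negation, which swaps the quantifiers and the answer. The literals
    are negated too; flipping the values of all variables restores them and does not affect a closed
    formula. *)
Lemma valid_cnf psi : qbf_wf psi ->
  let e := innermost psi == Exists in
  valid psi = ~~ e (+) qval (is_exists (outermost psi) (+) ~~ e) (qitems psi) (cnf psi) (fun=> false).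
Proof.
move=> wf; rewrite /valid -qval_prefix /=.
set q := is_exists _; set L := qitems _.
have D : depends_on predT (eval_matrix psi).
  move=> c c' H; rewrite /eval_matrix.
  by case: ifP => _; [apply: eq_all|apply: eq_has] => cl;
    [apply: eq_has|apply: eq_all] => l; rewrite /lit_true H.
have Dc : depends_on predT (cnf psi).
  by move=> c c' H; apply: cnf_depends => // x _; apply: H.
case e: (innermost psi == Exists) => /=; rewrite ?addbF ?addbT.
  apply: (@qval_ext _ _ _ _ _ _ predT) => // c c' H.
  by rewrite (D c c') // /eval_matrix e.
rewrite -[LHS]negbK -qval_neg; congr negb.
transitivity (qval (~~ q) L (fun c => cnf psi (flip c)) (fun=> false)).
  apply: (@qval_ext _ _ _ _ _ _ predT) => // c c' H.
  rewrite (D c c') // /eval_matrix e /cnf -all_predC; apply: eq_all => cl.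
  rewrite /= -has_predC; apply: eq_has => l.
  by rewrite /= /lit_true /flip; case: (c' _) l.1 => [] [].
rewrite qval_flip //; apply: (@qval_ext _ _ _ _ _ _ (mem (qvars psi))).
  exact: cnf_depends.
by move=> x xq; rewrite -mem_ivars ivars_qitems; rewrite /= in xq; rewrite xq.
Qed.

Lemma runs_main psi T W M E Bn q G :
  qbf_wf psi -> tree_decomposition psi T ->
  all (clause_ok W M) (qmatrix psi) -> names_ok W (qitems psi) ->
  (forall B, B \in bags T -> [/\ size B <= Bn,
     2 ^ size (ivars (restrict (mem B) (qitems psi))) <= E &
     cbound W (restrict (mem B) (qitems psi)) <= G]) ->
  size (qmatrix psi) * (M * (size (qitems psi) * (W + 2) + 2) + 2) +
    Bn * (W + 2) + 3 <= q ->
  let Q := E * ((size (qitems psi)).+2 * q) + Bn * (Bn * (W + 2) + G + 3) + G + 4 in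
  exists2 c, eval prog (tinput psi T) main (tbool (valid psi)) c &
    c <= 2 * Q * nnodes T + Q + sumn [seq (size Qi.2).+2 | Qi <- qblocks psi] +
      size (qblocks psi) + G + 5.
Proof.
move=> wf td okm okL HB leq_q Q.
have [uq _] := andP wf; have uL : uniq (ivars (qitems psi)) by rewrite ivars_qitems.
have sepT := crossing_separated (decomposition_crossing td).
have HB' B : B \in bags T -> [/\ uniq B, {subset B <= ivars (qitems psi)}, size B <= Bn,
     2 ^ size (ivars (restrict (mem B) (qitems psi))) <= E &
     cbound W (restrict (mem B) (qitems psi)) <= G].
  move=> BT; have [? ? ?] := HB B BT; split=> //; have [a <-] := bags_bag_at BT.
    exact: td_bag_uniq td a.
  by move=> x; rewrite ivars_qitems; apply: td_bag_sub td a x.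
have [c R Lc] := runs_type okm uL okL sepT HB' leq_q.
have {}Lc : c + Q <= 2 * Q * nnodes T := Lc.
have [ub bL bn bE bG] := HB' _ (bag_bags T).
(* The root is treated like the child of a node with an empty bag: its whole bag is forgotten. *)
have Rf : runs fforgetbag (tlist [:: tnames (bag T); Leaf;
  tsem (qmatrix psi) (qitems psi) T])
    (sem pred0 (mem (tvars T)) (tcheck (qmatrix psi) T) (qitems psi) (fun=> false))
    (size (bag T) * (G + 3)).
  have [|c' L' R'] := @runs_forgetbag W (bag T) [::] (mem (bag T)) (inner T)
    (tcheck (qmatrix psi) T) (qitems psi) (fun=> false) G uL okL ub _ bG.
    by move=> x xb; split; rewrite /inner /= ?xb ?andbF // bL.
  exists c'; first by apply: leq_trans L' _.
  congr (eval _ _ _ _ _): R'; apply: eq_sem => x _ /=; first by case: (x \in bag T).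
  rewrite /inner andbT; have := @bag_tvars T x.
  by case: (x \in bag T); case: (x \in tvars T) => //= H; have := H isT.
set u := sem _ _ _ _ _ in Rf.
have su : has_shape (restrict pred0 (qitems psi)) u := sem_shape _ _ _ _ _.
have Ln : all (pred1 None) (restrict pred0 (qitems psi)).
  by rewrite all_filter; apply/allP => -[].
have [s es] : exists s, u = tset s.
  case: (restrict _ _) Ln su => [|[x|] L] //= _; by case=> s [-> _ _]; exists s.
have su' : tsize (tlist s) <= G.
  have := shape_tsize (@names_ok_restrict W pred0 _ okL) su; rewrite es /=.
  have : cbound W (restrict pred0 (qitems psi)) <= G.
    by apply: leq_trans bG; apply: cbound_restrict.
  lia.
have cnt : count_mem None (restrict pred0 (qitems psi)) = qa psi.
  rewrite -count_qitems; elim: (qitems psi) => //= [[x|]] L' /= -> //.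
have [e eE] : {e | e = (innermost psi == Exists)} by eexists.
have ie : is_exists (innermost psi) = e by rewrite eE; case: innermost.
set q0 := is_exists (outermost psi) (+) ~~ e.
have cl : closed_last q0 (restrict pred0 (qitems psi)).
  by rewrite /closed_last cnt /q0 outermost_innermost ie; case: e {eE ie q0}; case: odd.
rewrite es in Ln su; have Rv := runs_veval Ln cl su.
have vE : valid psi = ~~ e (+) veval q0 (restrict pred0 (qitems psi)) (tset s).
  rewrite valid_cnf // -eE; congr addb; rewrite -es /u veval_sem.
  - apply: (@qval_ext _ _ _ _ _ _ predT) => // d d' H; rewrite tcheck_cnf //.
    by apply: cnf_depends => // x _; apply: H.
  - by move: cl; rewrite /closed_last cnt count_qitems.
  - move=> x; rewrite ivars_qitems => /(td_vertex td)[a xa].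
    by apply/mem_tvars; exists (bag_at T a); rewrite ?(bag_at_bags xa).
have bG' : size (bag T) * (G + 3) <= Q.
  apply: leq_trans (_ : Bn * (Bn * (W + 2) + G + 3) <= _).
    by rewrite leq_mul // leq_add2r leq_addl.
  rewrite /Q; set k := Bn * _; rewrite -!addnA.
  by apply: leq_trans (leq_addl _ _); apply: leq_addr.
have [v [c1 [c2 [Hev L1 [ev L2]]]]] : exists v c c', [/\ eval prog (tinput psi T) main v c',
    c' <= c & v = tbool (valid psi) /\ c <= 2 * Q * nnodes T + Q +
      sumn [seq (size Qi.2).+2 | Qi <- qblocks psi] + size (qblocks psi) + G + 5].
  apply: (wp_sound (Q := fun v c => v = tbool (valid psi) /\ c <= _)) => /=.
  call runs_items; call R; call Rf; rewrite es /=.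
  call (runs_last (qblocks psi) Forall); rewrite -/(innermost psi) ie vE.
  have out : (if tblocks (qblocks psi) is Fork a _ then a else Leaf) =
      tbool (is_exists (outermost psi)).
    by rewrite /outermost; case: (qblocks psi) => [|[q' ?] ?].
  set K := 2 * Q * nnodes T in Lc *; set N := size (bag T) * _ in bG' *.
  clear - Rv out Lc bG' su'; clearbody K N Q.
  move: out Rv; rewrite /q0 {q0}; case: is_exists; case: e;
    case: (tblocks _) => [|[|? ?] ?] //= _ Rv; call Rv; case: veval => /=;
    by split=> //; lia.
by exists c2; [rewrite -ev | apply: leq_trans L2].
Qed.

(** * Running time *)

Fixpoint ntower (h t : nat) : nat := if h is h'.+1 then 2 ^ ntower h' t else t.

Lemma leq_ntower h t t' : t <= t' -> ntower h t <= ntower h t'.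
Proof. by move=> le; elim: h => //= h IH; rewrite leq_exp2l. Qed.

Lemma ltn_ntower h t : ntower h t < ntower h t.+1.
Proof. by elim: h => //= h IH; rewrite ltn_exp2l. Qed.

Lemma ntower_double h t : 2 * ntower h.+1 t <= ntower h.+1 t.+1.
Proof. by rewrite /= -expnS leq_exp2l // ltn_ntower. Qed.

(** A variable squares the number of types, hence doubles an exponent, which one more unit at the
    top absorbs; an alternation adds a level. The start is [ntower 2 0 = 2], for the two truth
    values. *)
Lemma ntypes_tower L : ntypes L <= ntower (count_mem None L).+2 (size (ivars L)).
Proof.
elim: L => [//|[x|] L IH] /=; last by rewrite leq_exp2l.
apply: leq_trans (_ : (ntower (count_mem None L).+2 (size (ivars L))) ^ 2 <= _).
  by rewrite leq_exp2r.
by rewrite /= -expnM leq_exp2l // mulnC ntower_double.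
Qed.

(** The exponents at an alternation: 3 for the factor 8, [3 * 2 ^ z] for the cube and [u] for the
    remaining blocks. The two extra units at the top give [4 * z <= u]. *)
Lemma tower_step z u : 0 < z -> 4 * z <= u -> 3 + 3 * 2 ^ z + u <= 2 ^ u.
Proof.
case: u => [|u] z0 zu; first by lia.
have h1 : 3 * 2 ^ z <= 2 ^ u.
  apply: leq_trans (_ : 2 ^ (z + 2) <= _); last by rewrite leq_exp2l //; lia.
  by rewrite expnD; lia.
have h2 k : k.+3 + 4 <= 2 ^ k.+3.
  by elim: k => // k; rewrite (expnS 2 k.+3); lia.
have : u + 4 <= 2 ^ u.
  by case: u {h1} zu => [|[|[|u]]] zu; [lia|lia|lia|exact: h2].
by rewrite expnS; lia.
Qed.

Lemma cbound_single_block W L :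
  count_mem None L = 0 -> cbound W L = (W + 100) * 2 ^ size (ivars L).
Proof.
elim: L => [|[x|] L IH] /=; [by rewrite muln1| |by []].
by move=> /IH ->; rewrite expnS mulnCA.
Qed.

Lemma cbound_tower W L :
  cbound W L <= 8 * (W + 100) * ntower (count_mem None L).+1 (size (ivars L)).+2.
Proof.
elim: L => [|[x|] L IH]; first by rewrite /=; lia.
  have -> : cbound W (Some x :: L) = 2 * cbound W L by [].
  apply: leq_trans (leq_mul (leqnn 2) IH) _.
  by rewrite mulnCA leq_mul // ntower_double.
have T := ntypes_tower L; have H0 := @cbound_single_block W L.
rewrite [cbound _ _]/= [count_mem _ _]/= add1n [ivars _]/=.
move: (count_mem None L) (size (ivars L)) H0 IH T => h a H0 IH T.
have T3 : ntypes L ^ 3 <= 2 ^ (3 * ntower h.+1 a).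
  by rewrite mulnC expnM leq_exp2r.
move: (W + 100) H0 IH => K H0 IH.
(* If only one block remains, the induction hypothesis is too weak for small [a]. The exact value of
   [cbound] leaves the exponent [3 * 2 ^ a + a], which is at most [2 ^ (a + 2)]. *)
case: h H0 IH T T3 => [|h] H0 IH T T3.
  rewrite (H0 erefl) mulnACA leq_mul //.
  apply: leq_trans (leq_mul T3 (leqnn _)) _.
  rewrite -expnD leq_exp2l // [ntower 1 _]/= (expnD 2 2 a).
  have := ltn_expl a (isT : 1 < 2); rewrite /=; lia.
apply: leq_trans (leq_mul (leqnn _) IH) _.
rewrite (mulnC (8 * _)) -mulnA leq_mul //.
apply: leq_trans (leq_mul (leqnn _) (leq_mul (leqnn _) T3)) _.
have -> : 8 = 2 ^ 3 by [].
rewrite [ntower h.+2 a.+2]/= [ntower h.+3 _]/= -!expnD leq_exp2l //.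
have z0 : 0 < ntower h.+1 a by rewrite /= expn_gt0.
have := tower_step z0 (u := ntower h.+1 a.+2).
have := ntower_double h a.+1; have := ntower_double h a.
move=> d1 d2 /(_ ltac:(lia)); rewrite /=; lia.
Qed.

(** * Sizes of the encodings and the polynomial factor *)

Lemma size_enc_seq (A : Type) (enc : A -> seq symbol) s :
  size (enc_seq enc s) = sumn [seq size (enc a) | a <- s] + 2.
Proof. by rewrite /= size_cat size_flatten /shape -map_comp addn1 addn2. Qed.

Lemma leq_size_enc_seq (A : Type) (enc : A -> seq symbol) (f : A -> nat) s :
  (forall a, f a <= size (enc a)) ->
  sumn [seq f a | a <- s] <= size (enc_seq enc s).
Proof.
move=> H; rewrite size_enc_seq; elim: s => //= a s IH.
by rewrite -addnA leq_add.
Qed.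

Lemma size_enc_mem (A : eqType) (enc : A -> seq symbol) (a : A) s :
  a \in s -> size (enc a) <= size (enc_seq enc s).
Proof.
rewrite size_enc_seq; elim: s => //= b s IH; rewrite inE => /orP[/eqP ->|/IH].
  by rewrite -addnA leq_addr.
by move/leq_trans; apply; rewrite -addnA leq_addl.
Qed.

Lemma size_enc_len (A : Type) (enc : A -> seq symbol) s :
  (forall a, 0 < size (enc a)) -> size s <= size (enc_seq enc s).
Proof.
by move=> H; rewrite size_enc_seq; elim: s => //= a s; have := H a; lia.
Qed.

Lemma size_enc_nat x : size (enc_nat x) = size (bits x) + 2.
Proof. by rewrite /= size_cat size_map addn1 addn2. Qed.

Lemma tsize_tname x : tsize (tname x) <= 4 * size (enc_nat x).
Proof.
rewrite size_enc_nat /tname -lock.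
suff : tsize (tlist (map tbool (bits x))) <= 4 * size (bits x) by lia.
by elim: (bits x) => //= -[] s /=; lia.
Qed.

Lemma qvar_name psi x : x \in qvars psi -> tsize (tname x) <= 4 * qbf_size psi.
Proof.
rewrite -ivars_qitems /qbf_size /enc_qbf size_cat => xq.
apply: leq_trans (tsize_tname x) _; rewrite leq_mul //.
apply: leq_trans (leq_addr _ _).
have [Qi Qib xQi] : exists2 Qi, Qi \in qblocks psi & x \in Qi.2.
  move: xq; rewrite ivars_qitems /qvars /qprefix => /mapP[[q y] + /= ->].
  case/flattenP => s /mapP[Qi Qib ->] /mapP[z zQ [_ ->]].
  by exists Qi.
apply: leq_trans (size_enc_mem enc_block Qib).
by rewrite /enc_block; apply: leq_trans (size_enc_mem enc_nat xQi) (leqnSn _).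
Qed.

Lemma size_blocks psi : sumn [seq (size Qi.2).+2 | Qi <- qblocks psi] <= qbf_size psi.
Proof.
rewrite /qbf_size /enc_qbf size_cat; apply: leq_trans (leq_addr _ _).
apply: leq_size_enc_seq => -[q s];
  rewrite [X in _ <= X](_ : _ = (size (enc_seq enc_nat s)).+1) // size_enc_seq.
have : size s <= sumn [seq size (enc_nat a) | a <- s].
  by elim: s => //= x s; rewrite size_cat size_map; lia.
by rewrite /=; lia.
Qed.

Lemma size_block_items bl : size (block_items bl) <= sumn [seq (size Qi.2).+2 | Qi <- bl].
Proof.
elim: bl => //= -[q s] bl IH; rewrite size_cat size_map /=.
case: bl IH => [|[q' s'] bl] //= IH; first by lia.
by case: (q == q') => /=; lia.
Qed.

Lemma size_le_blocks (bl : seq (quantifier * seq nat)) :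
  size bl <= sumn [seq (size Qi.2).+2 | Qi <- bl].
Proof. by elim: bl => //= Qi bl; lia. Qed.

Lemma matrix_size psi W : qbf_wf psi -> (forall x, x \in qvars psi ->
  tsize (tname x) <= W) ->
  all (clause_ok W (qbf_size psi)) (qmatrix psi) && (size (qmatrix psi) <= qbf_size psi).
Proof.
case/andP=> _ /allP wf HW; rewrite /qbf_size /enc_qbf size_cat; apply/andP; split.
  apply/allP => c cm; apply/andP; split.
    apply: leq_trans (leq_addl _ _).
    apply: leq_trans (size_enc_mem (enc_seq enc_literal) cm).
    exact: size_enc_len.
  by apply/allP => l lc; apply: HW; apply: (allP (wf c cm)); apply: map_f.
by apply: leq_trans (leq_addl _ _); apply: size_enc_len.
Qed.

Lemma tdec_sizeE b ts : tdec_size (TNode b ts) =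
  size (enc_seq enc_nat b) + sumn [seq tdec_size t | t <- ts] + 2.
Proof.
rewrite /tdec_size -[enc_tdec _]/(enc_seq enc_nat b ++ enc_seq enc_tdec ts).
by rewrite size_cat (size_enc_seq enc_tdec) addnA.
Qed.

Lemma bag_size T B : B \in bags T ->
  (size B <= tdec_size T) && (size B <= max_bag_size T).
Proof.
elim/tdec_ind2: T => [b|b t ts IH1 IH2].
  rewrite inE => /eqP -> /=; rewrite leqnn andbT tdec_sizeE.
  by rewrite -addnA; apply: leq_trans (size_enc_len _ _) (leq_addr _ _).
rewrite bags_cons => /orP[/IH1|/IH2] /andP[h1 h2]; apply/andP; split.
- by apply: leq_trans h1 _; rewrite tdec_sizeE /=; lia.
- by apply: leq_trans h2 _; rewrite /= leq_maxl.
- by apply: leq_trans h1 _; rewrite !tdec_sizeE /=; lia.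
- by apply: leq_trans h2 _; rewrite /= leq_maxr.
Qed.

Lemma nnodes_size T : nnodes T <= tdec_size T.
Proof.
elim/tdec_ind2: T => [b|b t ts]; first by rewrite tdec_sizeE /=; lia.
by rewrite !tdec_sizeE /=; lia.
Qed.

(** These three polynomials are the bound of [runs_main] with all sizes at most [n] and the tower
    factored out. Names have size at most [4 * n], as a digit takes at most two forks; the terms
    [8 * (4 * n + 100)] come from [cbound_tower]. *)
Definition matrix_cost (n : nat) : nat :=
  n * (n * (n * (4 * n + 2) + 2) + 2) + n * (4 * n + 2) + 3.
Definition type_cost (n : nat) : nat :=
  (n + 2) * matrix_cost n + n * (n * (4 * n + 2) + 8 * (4 * n + 100) + 3) +
  8 * (4 * n + 100) + 4.
Definition total_cost (n : nat) : nat :=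
  2 * type_cost n * n + type_cost n + n + n + 8 * (4 * n + 100) + 5.

Lemma main_cost psi T : qbf_wf psi -> tree_decomposition psi T ->
  exists2 c, eval prog (tinput psi T) main (tbool (valid psi)) c &
    c <= total_cost (qbf_size psi + tdec_size T) *
         ntower (qa psi).+1 (max_bag_size T).+2.
Proof.
move=> wf td; set n := qbf_size psi + tdec_size T; set X := ntower _ _.
have X0 : 0 < X by rewrite /X /= expn_gt0.
have HW x : x \in qvars psi -> tsize (tname x) <= 4 * n.
  by move/qvar_name/leq_trans; apply; rewrite leq_mul // leq_addr.
have /andP[okm sm] := matrix_size wf HW.
have okL : names_ok (4 * n) (qitems psi).
  by move=> x; rewrite -mem_ivars ivars_qitems; apply: HW.
have nn : nnodes T <= n by apply: leq_trans (nnodes_size T) (leq_addl _ _).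
have sb : sumn [seq (size Qi.2).+2 | Qi <- qblocks psi] <= n.
  by apply: leq_trans (size_blocks psi) (leq_addr _ _).
have sL : size (qitems psi) <= n by apply: leq_trans (size_block_items _) sb.
have sb' := leq_trans (size_le_blocks _) sb.
have HB B : B \in bags T -> [/\ size B <= n,
     2 ^ size (ivars (restrict (mem B) (qitems psi))) <= X &
     cbound (4 * n) (restrict (mem B) (qitems psi)) <= 8 * (4 * n + 100) * X].
  move=> BT; have /andP[b1 b2] := bag_size BT.
  have sB : size (ivars (restrict (mem B) (qitems psi))) <= max_bag_size T.
    apply: leq_trans b2; rewrite ivars_restrict ivars_qitems.
    apply: uniq_leq_size; first by rewrite filter_uniq //; case/andP: wf.
    by move=> x; rewrite mem_filter => /andP[].
  have cnt : count_mem None (restrict (mem B) (qitems psi)) = qa psi.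
    rewrite -count_qitems; elim: (qitems psi) => //= [[x|]] L' /=; last by move=> ->.
    by case: (x \in B).
  split; first by apply: leq_trans b1 (leq_addl _ _).
    rewrite /X /= leq_exp2l //; apply: leq_trans sB _.
    elim: (qa psi) => [|h IH] /=; first by rewrite -addn2 leq_addr.
    by apply: leq_trans IH _; apply: ltnW; apply: ltn_expl.
  apply: leq_trans (cbound_tower _ _) _; rewrite cnt leq_mul //.
  by apply: leq_ntower; rewrite !ltnS.
have okm' : all (clause_ok (4 * n) n) (qmatrix psi).
  apply: sub_all okm => c /andP[h1 h2]; rewrite /clause_ok h2 andbT.
  by apply: leq_trans h1 (leq_addr _ _).
have sm' : size (qmatrix psi) <= n by apply: leq_trans sm (leq_addr _ _).
have leq_q : size (qmatrix psi) * (n * (size (qitems psi) * (4 * n + 2) + 2) + 2) +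
    n * (4 * n + 2) + 3 <= matrix_cost n.
  by rewrite /matrix_cost !leq_add2r !leq_mul // leq_add2r !leq_mul // leq_add2r !leq_mul.
have [c Hev Lc] := runs_main wf td okm' okL HB leq_q.
exists c => //; apply: leq_trans Lc _.
set Q := X * _ + _ + _ + 4; set K := 8 * (4 * n + 100).
have QX : Q <= type_cost n * X.
  have e : type_cost n * X = X * ((n + 2) * matrix_cost n) +
      n * (n * (4 * n + 2) * X + K * X + 3 * X) + K * X + 4 * X.
    by rewrite /type_cost -/K; nia.
  rewrite e /Q; apply: leq_add; last by lia.
  rewrite leq_add2r; apply: leq_add.
    by rewrite leq_mul // leq_mul // addn2 !ltnS.
  rewrite leq_mul //; apply: leq_add; last by lia.
  by rewrite leq_add2r leq_pmulr.
have -> : total_cost n * X = 2 * (type_cost n * X) * n + type_cost n * X + n * X +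
    n * X + K * X + 5 * X by rewrite /total_cost -/K; nia.
have nX : n <= n * X by rewrite leq_pmulr.
have h1 : 2 * Q * nnodes T <= 2 * (type_cost n * X) * n by rewrite !leq_mul.
apply: leq_add; last by lia.
rewrite leq_add2r; apply: leq_add; last exact: leq_trans sb' nX.
apply: leq_add; last exact: leq_trans sb nX.
exact: leq_add.
Qed.

Definition poly_bounded (f : nat -> nat) : Prop :=
  exists p : {poly nat}, forall n, (p.[n])%R = f n.

Lemma poly_bounded_const c : poly_bounded (fun=> c).
Proof. by exists (c%:P)%R => n; rewrite hornerC. Qed.

Lemma poly_bounded_id : poly_bounded id.
Proof. by exists ('X)%R => n; rewrite hornerX. Qed.

Lemma poly_boundedD f g :
  poly_bounded f -> poly_bounded g -> poly_bounded (fun n => f n + g n).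
Proof. by case=> p Hp [r Hr]; exists (p + r)%R => n; rewrite hornerD Hp Hr. Qed.

Lemma poly_boundedM f g :
  poly_bounded f -> poly_bounded g -> poly_bounded (fun n => f n * g n).
Proof. by case=> p Hp [r Hr]; exists (p * r)%R => n; rewrite hornerM Hp Hr. Qed.

Lemma poly_bounded_time k : poly_bounded (fun n => k * (n + total_cost n)).
Proof.
rewrite /total_cost /type_cost /matrix_cost.
by repeat first [apply: poly_bounded_const | apply: poly_bounded_id |
  apply: poly_boundedD | apply: poly_boundedM].
Qed.

Lemma time_bound t v n c C X :
  t <= v * (n + c) -> c <= C * X -> 0 < X -> t <= X * (v * (n + C)).
Proof.
move=> Lt Lc X0; apply: leq_trans Lt _; rewrite mulnCA leq_mul //.
by rewrite mulnDr leq_add ?leq_pmull // mulnC.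
Qed.

(** * From natural to real towers *)

Import Order.TTheory GRing.Theory Num.Theory.
Local Open Scope ring_scope.

Lemma tower_nat (R : realType) h n : tower h (n%:R : R) = (ntower h n)%:R.
Proof.
by elim: h => //= h ->; rewrite powR_mulrn ?ler0n // -natrX.
Qed.

Lemma ler_tower (R : realType) h (s t : R) : s <= t -> tower h s <= tower h t.
Proof. by move=> st; elim: h => //= h IH; rewrite ler_powR // ler1n. Qed.

Theorem theorem1 (R : realType) :
  exists (P : program) (p : {poly nat}),
    forall (psi : qbf) (T : tdec) (k : int),
      qbf_wf psi -> tree_decomposition psi T -> width T = k ->
      exists t : nat,
        outputs P (enc_qbf psi ++ enc_tdec T) t (valid psi) /\
        t%:R <= tower (qa psi).+1 (k%:~R + 392%:R / 100%:R : R)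
                * (p.[(qbf_size psi + tdec_size T)%N])%:R.
Proof.
have [p Hp] := poly_bounded_time (overhead prog main).
exists (run_main prog main), p => psi T k wf td <-.
have [c Hev Lc] := main_cost wf td.
have /andP[okd okm] := prog_calls_ok.
have [//|t Ht Lt] := run_mainP okd okm _ (tread_input psi T) Hev.
exists t; split=> //; rewrite Hp.
set n := (_ + tdec_size T)%N in Lc *; set B := max_bag_size T in Lc *.
set X := ntower _ _ in Lc.
have X0 : (0 < X)%N by rewrite /X /= expn_gt0.
rewrite size_cat -/(qbf_size psi) -/(tdec_size T) -/n in Lt.
have le1 := time_bound Lt Lc X0.
have le2 : X%:R <= tower (qa psi).+1 ((width T)%:~R + 392%:R / 100%:R : R).
  rewrite /X -(tower_nat R); apply: ler_tower.
  rewrite /width intrB -[Posz _]/(B%:Z) -pmulrn -(addn2 B) natrD; lra.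
apply: le_trans (_ : (X * (overhead prog main * (n + total_cost n)))%:R <= _).
  by rewrite ler_nat.
by rewrite natrM ler_wpM2r // ler0n.
Qed.
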